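(* Let $d,n\geq1$ be integers. The Jucys--Murphy elements $t_1,\dots,t_n,J_1,\dots,J_n$ generate a maximal commutative subalgebra of $\mathbb{C}(q){\rm Y}_{d,n}(q)$.
   Context: Let $q$ be an indeterminate. The Yokonuma--Hecke algebra ${\rm Y}_{d,n}(q)$ is the associative unital $\mathbb{C}[q,q^{-1}]$-algebra generated by $g_1,\dots,g_{n-1},t_1,\dots,t_n$ subject to: $g_ig_j=g_jg_i$ for $|i-j|>1$; $g_ig_{i+1}g_i=g_{i+1}g_ig_{i+1}$ for $i=1,\dots,n-2$; $t_it_j=t_jt_i$ for all $i,j$; $t_jg_i=g_it_{s_i(j)}$ for all $i,j$, where $s_i$ is the transposition $(i,i+1)$; $t_j^d=1$ for all $j$; and $g_i^2=1+(q-q^{-1})e_ig_i$ for all $i$, where $e_i=\frac1d\sum_{s=0}^{d-1}t_i^st_{i+1}^{-s}$. Write $\mathbb{C}(q){\rm Y}_{d,n}(q)=\mathbb{C}(q)\otimes_{\mathbb{C}[q,q^{-1}]}{\rm Y}_{d,n}(q)$, a $\mathbb{C}(q)$-algebra. The Jucys--Murphy elements are $t_1,\dots,t_n$ together with $J_1:=1$, $J_{i+1}:=g_iJ_ig_i$ for $i=1,\dots,n-1$. *)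

(* Defs.v *)
From HB Require Import structures.
From mathcomp Require Import all_boot all_order all_algebra.
From mathcomp Require Import perm.
From mathcomp Require Import boolp classical_sets reals.
From mathcomp Require Import complex monalg.

Set Implicit Arguments.
Unset Strict Implicit.
Unset Printing Implicit Defensive.

Import GRing.Theory.
Local Open Scope ring_scope.
Local Open Scope quotient_scope.
Local Open Scope classical_set_scope.

(* F(q) is {fraction {poly F}}, with indeterminate q = 'X%:F, and F[q,q^-1]
   is realized as the subring of F(q) of the fractions p / q^m. *)
Local Notation "x %:F" := (@FracField.tofrac _ x).

Section Laurent.
Variable F : fieldType.
Local Notation K := {fraction {poly F}}.
Local Notation q := (('X : {poly F})%:F : K).

Definition is_laurent : {pred K} :=
  fun x => `[< exists (p : {poly F}) (m : nat), x = p%:F / q ^+ m >].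

Lemma fracX_neq0 : q != 0.
Proof. by rewrite tofrac_eq0 polyX_eq0. Qed.

Lemma is_laurent_subring : subring_closed is_laurent.
Proof.
have qm m : q ^+ m != 0 by rewrite expf_neq0 // fracX_neq0.
split.
- by apply/asboolP; exists 1, 0%N; rewrite expr0 invr1 mulr1 tofrac1.
- move=> x y /asboolP[p [k ->]] /asboolP[p' [k' ->]]; apply/asboolP.
  exists (p * 'X^k' - p' * 'X^k), (k + k')%N.
  rewrite tofracB !tofracM !tofracXn exprD invfM mulrBl.
  congr (_ - _); first by rewrite mulrACA divff ?mulr1.
  by rewrite [(_ ^+ k)^-1 * _]mulrC mulrACA divff ?mulr1.
- move=> x y /asboolP[p [k ->]] /asboolP[p' [k' ->]]; apply/asboolP.
  by exists (p * p'), (k + k')%N; rewrite tofracM exprD invfM mulrACA.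
Qed.

HB.instance Definition _ :=
  GRing.isSubringClosed.Build K is_laurent is_laurent_subring.

Record laurent := Laurent { laurent_val : K; _ : laurent_val \in is_laurent }.

HB.instance Definition _ := [isSub for laurent_val].
HB.instance Definition _ := [Choice of laurent by <:].
HB.instance Definition _ := [SubChoice_isSubComNzRing of laurent by <:].

Lemma is_laurentC (c : F) : c%:P%:F \in is_laurent.
Proof. by apply/asboolP; exists c%:P, 0%N; rewrite expr0 divr1. Qed.

Lemma is_laurentX : q \in is_laurent.
Proof. by apply/asboolP; exists 'X, 0%N; rewrite expr0 divr1. Qed.

Lemma is_laurentXV : q^-1 \in is_laurent.
Proof. by apply/asboolP; exists 1, 1%N; rewrite tofrac1 mul1r expr1. Qed.

Definition laurentC (c : F) : laurent := Laurent (is_laurentC c).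
Definition laurentX : laurent := Laurent is_laurentX.
Definition laurentXV : laurent := Laurent is_laurentXV.

Lemma laurentXVE : laurentX * laurentXV = 1.
Proof. by apply: val_inj; rewrite /= divff // fracX_neq0. Qed.

Lemma laurentC_nat k : laurentC k%:R = k%:R.
Proof. apply: val_inj; rewrite rmorph_nat; transitivity ((k%:R : F)%:P%:F) => //.
by rewrite !rmorph_nat. Qed.

Lemma laurentCM : {morph laurentC : x y / x * y}.
Proof. by move=> x y; apply: val_inj; rewrite /= polyCM tofracM. Qed.

Lemma laurentC1 : laurentC 1 = 1.
Proof. exact: (laurentC_nat 1). Qed.

Definition laurent_ring : comNzRingType := GRing.ComNzRing.clone laurent _.

End Laurent.

(* The noncommutative free algebra on X is the monoid algebra of the free
   monoid {fmonom X}. *)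
Section FreeAlgebra.
Variables (R : comNzRingType) (X : choiceType).

Local Notation MA := {malg R[{fmonom X}]}.

Definition free_alg : Type := MA.

HB.instance Definition _ := GRing.Lmodule.on free_alg.

(* The product is sealed only to keep conversion tests cheap. *)
Definition free_mul : free_alg -> free_alg -> free_alg :=
  locked (fun x y : MA => x * y).

Lemma free_mulE (x y : free_alg) : free_mul x y = (x : MA) * (y : MA).
Proof. by rewrite /free_mul -lock. Qed.

Fact free_mulA : associative free_mul.
Proof. by move=> x y z; rewrite !free_mulE; exact: (@mulrA MA). Qed.
Fact free_mul1l : left_id (1 : MA) free_mul.
Proof. by move=> x; rewrite free_mulE; exact: (@mul1r MA). Qed.
Fact free_mul1r : right_id (1 : MA) free_mul.
Proof. by move=> x; rewrite free_mulE; exact: (@mulr1 MA). Qed.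
Fact free_mulDl : left_distributive free_mul +%R.
Proof. by move=> x y z; rewrite !free_mulE; exact: (@mulrDl MA). Qed.
Fact free_mulDr : right_distributive free_mul +%R.
Proof. by move=> x y z; rewrite !free_mulE; exact: (@mulrDr MA). Qed.
Fact free_1_neq0 : (1 : MA) != 0.
Proof. exact: (@oner_neq0 MA). Qed.

HB.instance Definition _ := GRing.Zmodule_isNzRing.Build free_alg
  free_mulA free_mul1l free_mul1r free_mulDl free_mulDr free_1_neq0.

Lemma free_malgM (x y : free_alg) : x * y = (x : MA) * (y : MA) :> MA.
Proof. exact: free_mulE. Qed.

Fact free_scaleAl (c : R) (x y : free_alg) : c *: (x * y) = (c *: x : free_alg) * y.
Proof. by rewrite !free_malgM; exact: (@scalerAl R MA). Qed.
HB.instance Definition _ :=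
  GRing.Lmodule_isLalgebra.Build R free_alg free_scaleAl.

Fact malgC_comm (c : R) (x : MA) : x * malgC c = malgC c * x.
Proof.
have UU a b (u v : {fmonom X}) :
    (<< a *g u >> : MA) * << b *g v >> = << a * b *g mmul u v >>.
  by rewrite malgM_def fgmulUU.
rewrite [x in LHS]monalgE mulr_suml [x in RHS]monalgE mulr_sumr.
by apply: eq_bigr => m _; rewrite !UU mulm1 mul1m mulrC.
Qed.

Fact free_scaleAr (c : R) (x y : free_alg) : c *: (x * y) = x * (c *: y : free_alg).
Proof.
rewrite !free_malgM; set u : MA := x; set v : MA := y.
rewrite -[LHS]/((c *: (u * v) : MA)) -[RHS]/(u * (c *: v) : MA).
have scE (z : MA) : c *: z = malgC c * z by rewrite mul_malgC.
rewrite (scE v) (scE (u * v)).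
by rewrite (@mulrA MA (malgC c) u v) -(malgC_comm c u) -(@mulrA MA u).
Qed.
HB.instance Definition _ :=
  GRing.Lalgebra_isAlgebra.Build R free_alg free_scaleAr.

Definition free_gen (x : X) : free_alg := << fmu x >>.

Variable h : X -> R.

Definition fmonom_eval (m : {fmonom X}) : R := \prod_(x <- (m : seq X)) h x.

Lemma fmonom_eval_morph : mmorphism fmonom_eval.
Proof.
split=> [x y|]; rewrite /fmonom_eval.
  by rewrite /mmul /= /fmmul fmE /= big_cat.
by rewrite /mone /= /fmone fmE /= big_nil.
Qed.

HB.instance Definition _ :=
  isMultiplicative.Build {fmonom X} R fmonom_eval fmonom_eval_morph.

Definition free_eval : free_alg -> R := mmap idfun fmonom_eval.

Lemma free_eval_gen x : free_eval (free_gen x) = h x.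
Proof.
rewrite /free_eval /free_gen mmapU /= mul1r /fmonom_eval /fmu fmE /=.
by rewrite big_seq1.
Qed.

Lemma free_eval1 : free_eval 1 = 1. Proof. exact: mmap1. Qed.
Lemma free_eval0 : free_eval 0 = 0. Proof. exact: mmap0. Qed.
Lemma free_evalD : {morph free_eval : x y / x + y}. Proof. exact: mmapD. Qed.
Lemma free_evalB : {morph free_eval : x y / x - y}. Proof. exact: mmapB. Qed.
Lemma free_evalM : {morph free_eval : x y / x * y}.
Proof. by move=> x y; rewrite free_malgM; exact: (rmorphM (mmap idfun fmonom_eval)). Qed.
Lemma free_evalX k : {morph free_eval : x / x ^+ k}.
Proof.
by move=> x; elim: k => [|k IH]; rewrite ?free_eval1 // !exprS free_evalM IH.
Qed.
Lemma free_evalZ c x : free_eval (c *: x) = c * free_eval x.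
Proof. exact: mmapZ. Qed.
Lemma free_eval_sum1 (s : seq nat) (f : nat -> free_alg) :
  (forall i, free_eval (f i) = 1) ->
  free_eval (\sum_(i <- s) f i) = (size s)%:R.
Proof.
move=> f1; elim: s => [|i s IH]; first by rewrite big_nil free_eval0.
by rewrite big_cons free_evalD IH f1 -natr1 addrC.
Qed.

End FreeAlgebra.

Section IdealQuotient.
Variables (R : comNzRingType) (A : algType R).

Definition two_sided_ideal (I : set A) : Prop :=
  [/\ I 0, forall x y, I x -> I y -> I (x - y)
    & forall a x b, I x -> I (a * x * b)].

Definition ideal_gen (S : set A) : set A := smallest two_sided_ideal S.

Lemma ideal_genP S : two_sided_ideal (ideal_gen S).
Proof.
split=> [I [[I0 _ _] _]//|x y Ix Iy I hI|a x b Ix I hI].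
- by have [[_ IB _] _] := hI; apply: IB; [apply: Ix|apply: Iy].
- by have [[_ _ IM] _] := hI; apply: IM; apply: Ix.
Qed.

(* The properness field makes the quotient a nontrivial ring, as the
   hierarchy of algebras requires. *)
Record proper_ideal := ProperIdeal {
  ideal_set : set A;
  ideal_setP : two_sided_ideal ideal_set;
  ideal_set1 : ~ ideal_set 1 }.

Variable I : proper_ideal.

Definition in_ideal : {pred A} := fun x => `[< ideal_set I x >].

Lemma in_ideal_zmod : zmod_closed in_ideal.
Proof.
have [I0 IB _] := ideal_setP I; split; first exact/asboolP.
by move=> x y /asboolP Ix /asboolP Iy; apply/asboolP/IB.
Qed.

HB.instance Definition _ := GRing.isZmodClosed.Build A in_ideal in_ideal_zmod.

Lemma in_idealM a x b : x \in in_ideal -> a * x * b \in in_ideal.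
Proof.
by have [_ _ IM] := ideal_setP I; move=> /asboolP Ix; apply/asboolP/IM.
Qed.

Definition quot_alg := Quotient.quot in_ideal.
HB.instance Definition _ := GRing.Zmodule.on quot_alg.

Definition quot_pi (x : A) : quot_alg := \pi_(Quotient.quot in_ideal) x.

Lemma quot_piP (x y : A) : quot_pi x = quot_pi y <-> ideal_set I (x - y).
Proof.
split=> [/eqP|Ixy]; first by rewrite -Quotient.idealrBE => /asboolP.
by apply/eqP; rewrite -Quotient.idealrBE; apply/asboolP.
Qed.

Lemma quot_piE (x : quot_alg) : quot_pi (repr x) = x.
Proof. exact: reprK. Qed.

Definition quot_mul : quot_alg -> quot_alg -> quot_alg :=
  locked (fun x y => quot_pi (repr x * repr y)).
Definition quot_scale : R -> quot_alg -> quot_alg :=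
  locked (fun c x => quot_pi (c *: repr x)).

Lemma quot_piM : {morph quot_pi : x y / x * y >-> quot_mul x y}.
Proof.
have [_ IB IM] := ideal_setP I.
move=> x y; rewrite /quot_mul -lock; apply/quot_piP.
have hx : ideal_set I (x - repr (quot_pi x)) by apply/quot_piP; rewrite quot_piE.
have hy : ideal_set I (repr (quot_pi y) - y) by apply/quot_piP; rewrite quot_piE.
set x' := repr _ in hx *; set y' := repr _ in hy *.
have -> : x * y - x' * y' = 1 * (x - x') * y - x' * (y' - y) * 1.
  by rewrite mul1r mulr1 mulrBl mulrBr opprB addrA addrNK.
by apply: IB; apply: IM.
Qed.

Lemma quot_piZ c : {morph quot_pi : x / c *: x >-> quot_scale c x}.
Proof.
have [_ _ IM] := ideal_setP I.
move=> x; rewrite /quot_scale -lock; apply/quot_piP.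
rewrite -scalerBr -[X in _ *: X]mul1r scalerAl -[X in ideal_set I X]mulr1.
by apply: IM; apply/quot_piP; rewrite quot_piE.
Qed.

Lemma quot_piD : {morph quot_pi : x y / x + y}.
Proof. exact: (raddfD (\pi_(Quotient.quot in_ideal))). Qed.

Fact quot_mulA : associative quot_mul.
Proof.
move=> x y z; rewrite -[x]quot_piE -[y]quot_piE -[z]quot_piE.
by rewrite -!quot_piM mulrA.
Qed.
Fact quot_mul1l : left_id (quot_pi 1) quot_mul.
Proof. by move=> x; rewrite -[x]quot_piE -!quot_piM mul1r. Qed.
Fact quot_mul1r : right_id (quot_pi 1) quot_mul.
Proof. by move=> x; rewrite -[x]quot_piE -!quot_piM mulr1. Qed.
Fact quot_mulDl : left_distributive quot_mul +%R.
Proof.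
move=> x y z; rewrite -[x]quot_piE -[y]quot_piE -[z]quot_piE.
by rewrite -quot_piD -!quot_piM -quot_piD mulrDl.
Qed.
Fact quot_mulDr : right_distributive quot_mul +%R.
Proof.
move=> x y z; rewrite -[x]quot_piE -[y]quot_piE -[z]quot_piE.
by rewrite -quot_piD -!quot_piM -quot_piD mulrDr.
Qed.
Fact quot_1_neq0 : quot_pi 1 != 0.
Proof.
apply/eqP => h; apply: (ideal_set1 (p := I)).
rewrite -[1]subr0; apply/quot_piP; rewrite h.
exact: esym (raddf0 (\pi_(Quotient.quot in_ideal))).
Qed.

HB.instance Definition _ := GRing.Zmodule_isNzRing.Build quot_alg
  quot_mulA quot_mul1l quot_mul1r quot_mulDl quot_mulDr quot_1_neq0.

Fact quot_scaleA a b x : quot_scale a (quot_scale b x) = quot_scale (a * b) x.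
Proof. by rewrite -[x]quot_piE -!quot_piZ scalerA. Qed.
Fact quot_scale1 : left_id 1 quot_scale.
Proof. by move=> x; rewrite -[x]quot_piE -!quot_piZ scale1r. Qed.
Fact quot_scaleDr : right_distributive quot_scale +%R.
Proof.
move=> c x y; rewrite -[x]quot_piE -[y]quot_piE.
by rewrite -quot_piD -!quot_piZ -quot_piD scalerDr.
Qed.
Fact quot_scaleDl x : {morph quot_scale^~ x : a b / a + b}.
Proof.
by move=> a b; rewrite -[x]quot_piE -!quot_piZ -quot_piD scalerDl.
Qed.

HB.instance Definition _ := GRing.Zmodule_isLmodule.Build R quot_alg
  quot_scaleA quot_scale1 quot_scaleDr quot_scaleDl.

Fact quot_scaleAl c (x y : quot_alg) : c *: (x * y) = (c *: x) * y.
Proof.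
rewrite -[x]quot_piE -[y]quot_piE.
by rewrite -[LHS]/(quot_scale c (quot_mul _ _))
  -[RHS]/(quot_mul (quot_scale c _) _) -!(quot_piM, quot_piZ) scalerAl.
Qed.
HB.instance Definition _ := GRing.Lmodule_isLalgebra.Build R quot_alg
  quot_scaleAl.

Fact quot_scaleAr c (x y : quot_alg) : c *: (x * y) = x * (c *: y).
Proof.
rewrite -[x]quot_piE -[y]quot_piE.
by rewrite -[LHS]/(quot_scale c (quot_mul _ _))
  -[RHS]/(quot_mul _ (quot_scale c _)) -!(quot_piM, quot_piZ) scalerAr.
Qed.
HB.instance Definition _ := GRing.Lalgebra_isAlgebra.Build R quot_alg
  quot_scaleAr.

End IdealQuotient.

Section YokonumaHecke.
Variables (F : fieldType) (d n : nat).
Local Notation L := (laurent_ring F).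
Local Notation q := (laurentX F).
Local Notation qV := (laurentXV F).

(* Indices start at 0: inl i stands for g_(i+1) and inr j for t_(j+1), and the
   transposition s_(i+1) exchanges the positions ord_lo i and ord_hi i. *)
Definition ord_lo (i : 'I_n.-1) : 'I_n := widen_ord (leq_pred n) i.
Lemma ord_hi_subproof (i : 'I_n.-1) : (i.+1 < n)%N.
Proof. by rewrite -ltn_predRL. Qed.
Definition ord_hi (i : 'I_n.-1) : 'I_n := Ordinal (ord_hi_subproof i).

Definition yh_gen : choiceType := ('I_n.-1 + 'I_n)%type.
Local Notation FA := (free_alg L yh_gen).

Definition free_g (i : 'I_n.-1) : FA := free_gen L (inl i : yh_gen).
Definition free_t (j : 'I_n) : FA := free_gen L (inr j : yh_gen).

(* As t^d = 1 is imposed, t^(-s) is t^(d - s) for s < d. *)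
Definition free_e (i : 'I_n.-1) : FA :=
  laurentC d%:R^-1 *:
    \sum_(0 <= s < d) free_t (ord_lo i) ^+ s * free_t (ord_hi i) ^+ (d - s).

Inductive yh_relator : set FA :=
| yh_comm_g (i j : 'I_n.-1) : (i.+1 < j)%N || (j.+1 < i)%N ->
    yh_relator (free_g i * free_g j - free_g j * free_g i)
| yh_braid (i j : 'I_n.-1) : j = i.+1 :> nat ->
    yh_relator (free_g i * free_g j * free_g i - free_g j * free_g i * free_g j)
| yh_comm_t (i j : 'I_n) :
    yh_relator (free_t i * free_t j - free_t j * free_t i)
| yh_tg (i : 'I_n.-1) (j : 'I_n) :
    yh_relator (free_t j * free_g i
                - free_g i * free_t (tperm (ord_lo i) (ord_hi i) j))
| yh_t_order (j : 'I_n) : yh_relator (free_t j ^+ d - 1)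
| yh_quadratic (i : 'I_n.-1) :
    yh_relator (free_g i ^+ 2 - (1 + (q - qV) *: (free_e i * free_g i))).

(* The relators vanish under the character t_j |-> 1, g_i |-> q (g_i |-> 1
   in the degenerate case d = 0 in F), so the ideal is proper. *)
Definition yh_char (x : yh_gen) : L :=
  if x is inl _ then (if d%:R == 0 :> F then 1 else q) else 1.

Lemma yh_char_relator x : yh_relator x -> free_eval yh_char x = 0.
Proof.
have eg i : free_eval yh_char (free_g i) = if d%:R == 0 :> F then 1 else q.
  by rewrite free_eval_gen.
have et j : free_eval yh_char (free_t j) = 1 by rewrite free_eval_gen.
case=> {x} [i j _|i j _|i j|i j|j|i]; rewrite free_evalB.
- by rewrite !free_evalM !eg subrr.
- by rewrite !free_evalM !eg subrr.
- by rewrite !free_evalM !et subrr.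
- by rewrite !free_evalM !et eg mul1r mulr1 subrr.
- by rewrite free_evalX et expr1n free_eval1 subrr.
have ee : free_eval yh_char (free_e i) = laurentC (d%:R^-1 * d%:R).
  rewrite /free_e free_evalZ free_eval_sum1; last first.
    by move=> s; rewrite free_evalM !free_evalX !et !expr1n mulr1.
  by rewrite size_iota subn0 laurentCM laurentC_nat.
rewrite free_evalD free_eval1 free_evalZ free_evalM ee free_evalX eg.
case: eqP => [->|/eqP d0].
  by rewrite mulr0 (laurentC_nat F 0) mul0r mulr0 addr0 expr1n subrr.
rewrite mulVf // laurentC1 mul1r mulrBl [qV * q]mulrC laurentXVE.
by rewrite (addrC 1) subrK expr2 subrr.
Qed.

Lemma yh_ideal_eval x : ideal_gen yh_relator x -> free_eval yh_char x = 0.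
Proof.
apply: (smallest_sub (X := [set x | free_eval yh_char x = 0])).
- split=> [|u v /= u0 v0|a u b /= u0]; first exact: free_eval0.
  + by rewrite free_evalB u0 v0 subr0.
  + by rewrite !free_evalM u0 mulr0 mul0r.
- exact: yh_char_relator.
Qed.

Fact yh_ideal1 : ~ ideal_gen yh_relator 1.
Proof. by move/yh_ideal_eval/eqP; rewrite free_eval1 oner_eq0. Qed.

Definition yh_ideal : proper_ideal FA :=
  ProperIdeal (ideal_genP yh_relator) yh_ideal1.

Definition yh := quot_alg yh_ideal.
HB.instance Definition _ := GRing.Algebra.on yh.

Definition yh_g (i : 'I_n.-1) : yh := quot_pi yh_ideal (free_g i).
Definition yh_t (j : 'I_n) : yh := quot_pi yh_ideal (free_t j).

(* yh_J k is J_(k+1) for k < n; the value 0 for k >= n is a dummy. *)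
Fixpoint yh_J (k : nat) : yh :=
  if k is k'.+1 then
    if insub k' is Some i then yh_g i * yh_J k' * yh_g i else 0
  else 1.

End YokonumaHecke.

(* K ⊗_R Y for a commutative R-algebra K (with structure map f) and an
   R-algebra Y: finite formal sums of pure tensors modulo bilinearity. *)
Section Tensor.
Variables (R K : comNzRingType) (f : {rmorphism R -> K}) (Y : algType R).

Inductive tensor_eq : seq (K * Y) -> seq (K * Y) -> Prop :=
| tensor_refl s : tensor_eq s s
| tensor_sym s t : tensor_eq s t -> tensor_eq t s
| tensor_trans s t u : tensor_eq s t -> tensor_eq t u -> tensor_eq s u
| tensor_cat s s' t t' :
    tensor_eq s s' -> tensor_eq t t' -> tensor_eq (s ++ t) (s' ++ t')
| tensor_catC s t : tensor_eq (s ++ t) (t ++ s)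
| tensor_addl k k' y : tensor_eq [:: (k + k', y)] [:: (k, y); (k', y)]
| tensor_addr k y y' : tensor_eq [:: (k, y + y')] [:: (k, y); (k, y')]
| tensor_zerol y : tensor_eq [:: (0, y)] [::]
| tensor_zeror k : tensor_eq [:: (k, 0)] [::]
| tensor_balance k r y : tensor_eq [:: (k * f r, y)] [:: (k, r *: y)].

Definition tensor_eqb : rel (seq (K * Y)) := fun s t => `[< tensor_eq s t >].

Fact tensor_eqb_equiv : equiv_class_of tensor_eqb.
Proof.
split=> [s|s t|t s u]; first exact/asboolP/tensor_refl.
  by apply/asboolP/asboolP; apply: tensor_sym.
by move=> /asboolP h /asboolP h'; apply/asboolP; apply: tensor_trans h h'.
Qed.

Canonical tensor_equiv := EquivRelPack tensor_eqb_equiv.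
Canonical tensor_encModRel := defaultEncModRel tensor_eqb.

Definition tensor := {eq_quot tensor_eqb}.
HB.instance Definition _ := Choice.on tensor.

Definition tensor_pi (s : seq (K * Y)) : tensor := \pi_({eq_quot tensor_eqb}) s.

Definition pure (k : K) (y : Y) : tensor := tensor_pi [:: (k, y)].

Lemma tensor_piP s t : tensor_pi s = tensor_pi t <-> tensor_eq s t.
Proof.
split=> [/eqmodP/asboolP//|h].
by apply/eqmodP/asboolP.
Qed.

Lemma tensor_piE (x : tensor) : tensor_pi (repr x) = x.
Proof. exact: reprK. Qed.

Lemma tensor_reprP s : tensor_eq s (repr (tensor_pi s)).
Proof. by apply/tensor_piP; rewrite tensor_piE. Qed.

Local Notation seqopp := (map (fun x : K * Y => (- x.1, x.2))).
Local Notation seqscale k := (map (fun x : K * Y => (k * x.1, x.2))).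
Local Notation seqmul s t :=
  [seq ((x : K * Y).1 * (y : K * Y).1, (x : K * Y).2 * (y : K * Y).2)
  | x <- s, y <- t].

Definition tensor_add : tensor -> tensor -> tensor :=
  locked (fun x y => tensor_pi (repr x ++ repr y)).
Definition tensor_opp : tensor -> tensor :=
  locked (fun x => tensor_pi (seqopp (repr x))).
Definition tensor_scale : K -> tensor -> tensor :=
  locked (fun k x => tensor_pi (seqscale k (repr x))).
Definition tensor_mul : tensor -> tensor -> tensor :=
  locked (fun x y => tensor_pi (seqmul (repr x) (repr y))).

(* A map on pure tensors extended to formal sums preserves tensor_eq as soon
   as it preserves the generating relations. *)
Lemma tensor_flatmap (h : K * Y -> seq (K * Y)) :
  (forall k k' y, tensor_eq (h (k + k', y)) (h (k, y) ++ h (k', y))) ->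
  (forall k y y', tensor_eq (h (k, y + y')) (h (k, y) ++ h (k, y'))) ->
  (forall y, tensor_eq (h (0, y)) [::]) ->
  (forall k, tensor_eq (h (k, 0)) [::]) ->
  (forall k r y, tensor_eq (h (k * f r, y)) (h (k, r *: y))) ->
  forall s t, tensor_eq s t ->
    tensor_eq (flatten (map h s)) (flatten (map h t)).
Proof.
move=> hDl hDr h0l h0r hb s t; elim=> {s t} /=.
- by move=> s; apply: tensor_refl.
- by move=> s t _ /tensor_sym.
- by move=> s t u _ st _; apply: tensor_trans.
- by move=> s s' t t' _ ss' _ tt'; rewrite !map_cat !flatten_cat; apply: tensor_cat.
- by move=> s t; rewrite !map_cat !flatten_cat; apply: tensor_catC.
- by move=> k k' y; rewrite !cats0.
- by move=> k y y'; rewrite !cats0.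
- by move=> y; rewrite cats0.
- by move=> k; rewrite cats0.
- by move=> k r y; rewrite !cats0.
Qed.

Lemma tensor_map (h : K * Y -> K * Y) s t :
  (forall k k' y, tensor_eq [:: h (k + k', y)] [:: h (k, y); h (k', y)]) ->
  (forall k y y', tensor_eq [:: h (k, y + y')] [:: h (k, y); h (k, y')]) ->
  (forall y, tensor_eq [:: h (0, y)] [::]) ->
  (forall k, tensor_eq [:: h (k, 0)] [::]) ->
  (forall k r y, tensor_eq [:: h (k * f r, y)] [:: h (k, r *: y)]) ->
  tensor_eq s t -> tensor_eq (map h s) (map h t).
Proof.
move=> *; have E u : map h u = flatten (map (fun x => [:: h x]) u).
  by elim: u => //= x u ->.
by rewrite !E; apply: tensor_flatmap.
Qed.

Lemma tensor_seqscale k s t :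
  tensor_eq s t -> tensor_eq (seqscale k s) (seqscale k t).
Proof.
apply: tensor_map => /=.
- by move=> *; rewrite mulrDr; apply: tensor_addl.
- by move=> *; apply: tensor_addr.
- by move=> *; rewrite mulr0; apply: tensor_zerol.
- by move=> *; apply: tensor_zeror.
- by move=> *; rewrite mulrA; apply: tensor_balance.
Qed.

Lemma tensor_seqopp s t : tensor_eq s t -> tensor_eq (seqopp s) (seqopp t).
Proof.
apply: tensor_map => /=.
- by move=> *; rewrite opprD; apply: tensor_addl.
- by move=> *; apply: tensor_addr.
- by move=> *; rewrite oppr0; apply: tensor_zerol.
- by move=> *; apply: tensor_zeror.
- by move=> *; rewrite -mulNr; apply: tensor_balance.
Qed.

Lemma seqmul_cons x s t :
  seqmul (x :: s) t = [seq (x.1 * y.1, x.2 * y.2) | y <- t] ++ seqmul s t.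
Proof. by []. Qed.

Lemma tensor_seqmulr s t t' :
  tensor_eq t t' -> tensor_eq (seqmul s t) (seqmul s t').
Proof.
move=> tt'; elim: s => [|x s IH]; first exact: tensor_refl.
rewrite !seqmul_cons; apply: tensor_cat IH.
apply: tensor_map tt' => /=.
- by move=> *; rewrite mulrDr; apply: tensor_addl.
- by move=> *; rewrite mulrDr; apply: tensor_addr.
- by move=> *; rewrite mulr0; apply: tensor_zerol.
- by move=> *; rewrite mulr0; apply: tensor_zeror.
- by move=> *; rewrite mulrA -scalerAr; apply: tensor_balance.
Qed.

Lemma tensor_perm s t : perm_eq s t -> tensor_eq s t.
Proof.
elim: s t => [|x s IH] t.
  by rewrite perm_sym => /perm_nilP->; apply: tensor_refl.
move=> st; have xt : x \in t by rewrite -(perm_mem st) mem_head.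
case/splitPr: xt st => t1 t2.
rewrite perm_sym -[x :: t2]cat1s perm_catCA /= perm_cons perm_sym => /IH h.
apply: tensor_trans (tensor_cat (tensor_refl [:: x]) h) _.
rewrite -[x :: t2]cat1s !catA; apply: tensor_cat (tensor_refl _).
exact: tensor_catC.
Qed.

Lemma seqmul_swap s t :
  perm_eq (seqmul s t) [seq ((x.1 * y.1, x.2 * y.2) : K * Y) | y <- t, x <- s].
Proof.
elim: t => [|y t IH]; first by rewrite allpairs0r.
by rewrite perm_allpairs_consr /= perm_cat2l.
Qed.

Lemma tensor_seqmull s s' t :
  tensor_eq s s' -> tensor_eq (seqmul s t) (seqmul s' t).
Proof.
move=> ss'.
apply: tensor_trans (tensor_perm (seqmul_swap s t)) _.
apply: tensor_trans (tensor_sym (tensor_perm (seqmul_swap s' t))).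
elim: t => [|y t IH] /=; first exact: tensor_refl.
apply: tensor_cat IH.
apply: tensor_map ss' => /=.
- by move=> *; rewrite mulrDl; apply: tensor_addl.
- by move=> *; rewrite mulrDl; apply: tensor_addr.
- by move=> *; rewrite mul0r; apply: tensor_zerol.
- by move=> *; rewrite mul0r; apply: tensor_zeror.
- by move=> k r z; rewrite mulrAC -scalerAl; apply: tensor_balance.
Qed.

Lemma tensor_piD s t : tensor_add (tensor_pi s) (tensor_pi t) = tensor_pi (s ++ t).
Proof.
rewrite /tensor_add -lock; apply/tensor_piP.
by apply: tensor_cat; apply/tensor_sym/tensor_reprP.
Qed.

Lemma tensor_piN s : tensor_opp (tensor_pi s) = tensor_pi (seqopp s).
Proof.
rewrite /tensor_opp -lock; apply/tensor_piP.
exact/tensor_seqopp/tensor_sym/tensor_reprP.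
Qed.

Lemma tensor_piZ k s : tensor_scale k (tensor_pi s) = tensor_pi (seqscale k s).
Proof.
rewrite /tensor_scale -lock; apply/tensor_piP.
exact/tensor_seqscale/tensor_sym/tensor_reprP.
Qed.

Lemma tensor_piM s t : tensor_mul (tensor_pi s) (tensor_pi t) = tensor_pi (seqmul s t).
Proof.
rewrite /tensor_mul -lock; apply/tensor_piP.
apply: tensor_trans (tensor_seqmulr _ _) (tensor_seqmull _ _);
  exact/tensor_sym/tensor_reprP.
Qed.

Fact tensor_addA : associative tensor_add.
Proof.
move=> x y z; rewrite -[x]tensor_piE -[y]tensor_piE -[z]tensor_piE.
by rewrite !tensor_piD catA.
Qed.
Fact tensor_addC : commutative tensor_add.
Proof.
move=> x y; rewrite -[x]tensor_piE -[y]tensor_piE.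
by rewrite !tensor_piD; apply/tensor_piP/tensor_catC.
Qed.
Fact tensor_add0 : left_id (tensor_pi [::]) tensor_add.
Proof. by move=> x; rewrite -[x]tensor_piE tensor_piD. Qed.
Fact tensor_addN : left_inverse (tensor_pi [::]) tensor_opp tensor_add.
Proof.
move=> x; rewrite -[x]tensor_piE tensor_piN tensor_piD; apply/tensor_piP.
elim: (repr x) => [|[k y] s IH] /=; first exact: tensor_refl.
apply: (@tensor_trans _ ((seqopp s ++ s) ++ [:: (- k, y); (k, y)])).
  apply/tensor_perm/seq.permP => p; rewrite /= !count_cat /= addn0 -addnA addnCA.
  by congr (_ + _)%N; rewrite addnA addnC.
apply: tensor_trans (tensor_cat IH _) (tensor_refl [::]).
apply: tensor_trans (tensor_sym (tensor_addl _ _ _)) _.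
by rewrite addNr; apply: tensor_zerol.
Qed.

HB.instance Definition _ := GRing.isZmodule.Build tensor
  tensor_addA tensor_addC tensor_add0 tensor_addN.

Fact tensor_mulA : associative tensor_mul.
Proof.
move=> x y z; rewrite -[x]tensor_piE -[y]tensor_piE -[z]tensor_piE.
rewrite !tensor_piM; congr tensor_pi.
elim: (repr x) => [|a s IH] //; rewrite !seqmul_cons allpairs_cat -IH.
congr (_ ++ _); elim: (repr y) => [|b t IHt] //=.
rewrite map_cat IHt; congr (_ ++ _); rewrite -map_comp.
by apply: eq_map => c /=; rewrite !mulrA.
Qed.
Fact tensor_mul1l : left_id (pure 1 1) tensor_mul.
Proof.
move=> x; rewrite -[x]tensor_piE tensor_piM /= cats0; congr tensor_pi.
by rewrite -[RHS]map_id; apply: eq_map => -[k y]; rewrite !mul1r.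
Qed.
Fact tensor_mul1r : right_id (pure 1 1) tensor_mul.
Proof.
move=> x; rewrite -[x]tensor_piE tensor_piM; congr tensor_pi.
by elim: (repr x) => //= -[k y] s ->; rewrite !mulr1.
Qed.
Fact tensor_mulDl : left_distributive tensor_mul +%R.
Proof.
move=> x y z; rewrite -[x]tensor_piE -[y]tensor_piE -[z]tensor_piE.
rewrite -[LHS]/(tensor_mul (tensor_add _ _) _).
rewrite -[RHS]/(tensor_add (tensor_mul _ _) (tensor_mul _ _)).
by rewrite tensor_piD !tensor_piM tensor_piD allpairs_cat.
Qed.
Fact tensor_mulDr : right_distributive tensor_mul +%R.
Proof.
move=> x y z; rewrite -[x]tensor_piE -[y]tensor_piE -[z]tensor_piE.
rewrite -[LHS]/(tensor_mul _ (tensor_add _ _)).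
rewrite -[RHS]/(tensor_add (tensor_mul _ _) (tensor_mul _ _)).
rewrite tensor_piD !tensor_piM tensor_piD; apply/tensor_piP/tensor_perm.
elim: (repr x) => [|a s IH] //=; rewrite map_cat -!catA perm_cat2l.
apply: perm_trans (perm_cat (perm_refl _) IH) _.
by rewrite perm_catCA.
Qed.

HB.instance Definition _ := GRing.Zmodule_isPzRing.Build tensor
  tensor_mulA tensor_mul1l tensor_mul1r tensor_mulDl tensor_mulDr.

Fact tensor_scaleA a b x :
  tensor_scale a (tensor_scale b x) = tensor_scale (a * b) x.
Proof.
rewrite -[x]tensor_piE !tensor_piZ -map_comp; congr tensor_pi.
by apply: eq_map => y /=; rewrite mulrA.
Qed.
Fact tensor_scale1 : left_id 1 tensor_scale.
Proof.
move=> x; rewrite -[x]tensor_piE tensor_piZ; congr tensor_pi.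
by rewrite -[RHS]map_id; apply: eq_map => -[k y]; rewrite mul1r.
Qed.
Fact tensor_scaleDr : right_distributive tensor_scale +%R.
Proof.
move=> c x y; rewrite -[x]tensor_piE -[y]tensor_piE.
rewrite -[LHS]/(tensor_scale c (tensor_add _ _)) -[RHS]/(tensor_add _ _).
by rewrite tensor_piD !tensor_piZ tensor_piD map_cat.
Qed.
Fact tensor_scaleDl x : {morph tensor_scale^~ x : a b / a + b}.
Proof.
move=> a b; rewrite -[x]tensor_piE -[RHS]/(tensor_add _ _).
rewrite !tensor_piZ tensor_piD; apply/tensor_piP.
elim: (repr x) => [|[k y] s IH] /=; first exact: tensor_refl.
apply: (@tensor_trans _ ([:: (a * k, y); (b * k, y)] ++ (seqscale a s ++ seqscale b s))).
  rewrite -cat1s; apply: tensor_cat IH.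
  by rewrite mulrDl; apply: tensor_addl.
apply/tensor_perm/seq.permP => p; rewrite /= !count_cat /=.
by congr (_ + _)%N; rewrite addnCA.
Qed.

HB.instance Definition _ := GRing.Zmodule_isLmodule.Build K tensor
  tensor_scaleA tensor_scale1 tensor_scaleDr tensor_scaleDl.

Lemma tensor_scaleAl c (x y : tensor) :
  c *: (x * y) = (c *: x : tensor) * y.
Proof.
rewrite -[x]tensor_piE -[y]tensor_piE.
rewrite -[LHS]/(tensor_scale c (tensor_mul _ _)).
rewrite -[RHS]/(tensor_mul (tensor_scale c _) _).
rewrite tensor_piM !tensor_piZ tensor_piM; congr tensor_pi.
elim: (repr x) => //= a s IH; rewrite map_cat IH; congr (_ ++ _).
by rewrite -map_comp; apply: eq_map => b /=; rewrite mulrA.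
Qed.

Lemma tensor_scaleAr c (x y : tensor) :
  c *: (x * y) = x * (c *: y : tensor).
Proof.
rewrite -[x]tensor_piE -[y]tensor_piE.
rewrite -[LHS]/(tensor_scale c (tensor_mul _ _)).
rewrite -[RHS]/(tensor_mul _ (tensor_scale c _)).
rewrite tensor_piM !tensor_piZ tensor_piM; congr tensor_pi.
elim: (repr x) => //= a s IH; rewrite map_cat IH; congr (_ ++ _).
by rewrite -!map_comp; apply: eq_map => b /=; rewrite mulrCA.
Qed.

(* A K-algebra is nontrivial by definition in the hierarchy; K ⊗_R Y is so
   when Y has a character. *)
Lemma tensor_neq0 (chi : Y -> R) :
  chi 1 = 1 -> {morph chi : x y / x + y} ->
  (forall r y, chi (r *: y) = r * chi y) -> (1 : tensor) != 0.
Proof.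
move=> chi1 chiD chiZ.
have chi0 : chi 0 = 0 by rewrite -(scale0r 1) chiZ mul0r.
pose ev (s : seq (K * Y)) := \sum_(x <- s) x.1 * f (chi x.2).
have evP s t : tensor_eq s t -> ev s = ev t.
  rewrite /ev; elim=> {s t} //=.
  - by move=> s t u _ -> _ ->.
  - by move=> s s' t t' _ h _ h'; rewrite !big_cat /= h h'.
  - by move=> s t; rewrite !big_cat /= addrC.
  - by move=> k k' y; rewrite !big_cons big_nil !addr0 mulrDl.
  - by move=> k y y'; rewrite !big_cons big_nil !addr0 chiD rmorphD mulrDr.
  - by move=> y; rewrite big_seq1 big_nil mul0r.
  - by move=> k; rewrite big_seq1 big_nil chi0 rmorph0 mulr0.
  - by move=> k r y; rewrite !big_seq1 /= chiZ rmorphM mulrA.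
apply/eqP => /tensor_piP/evP; rewrite /ev big_seq1 big_nil /= chi1 rmorph1 mulr1.
by move/eqP; rewrite oner_eq0.
Qed.

End Tensor.

(* ratyh is F(q) ⊗ Y_{d,n}(q), the tensor product being over F[q,q^-1]. *)
Section RationalYokonumaHecke.
Variables (F : fieldType) (d n : nat).
Local Notation L := (laurent_ring F).
Local Notation K := {fraction {poly F}}.

Definition laurent_incl : L -> K := val.
HB.instance Definition _ := GRing.RMorphism.on laurent_incl.

Definition yh_chi (x : yh F d n) : L := free_eval (@yh_char F d n) (repr x).

Lemma yh_chi_pi x :
  yh_chi (quot_pi (yh_ideal F d n) x) = free_eval (@yh_char F d n) x.
Proof.
apply/eqP; rewrite -subr_eq0 -free_evalB; apply/eqP/yh_ideal_eval.
by apply: (quot_piP (yh_ideal F d n) _ _).1; rewrite quot_piE.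
Qed.

Definition ratyh := tensor laurent_incl (yh F d n).
HB.instance Definition _ := GRing.PzRing.on ratyh.
HB.instance Definition _ := GRing.Lmodule.on ratyh.

Fact ratyh_neq0 : (1 : ratyh) != 0.
Proof.
apply: (@tensor_neq0 _ _ _ _ yh_chi).
- exact: etrans (yh_chi_pi 1) (free_eval1 _).
- move=> x y; rewrite -[x]quot_piE -[y]quot_piE -quot_piD !yh_chi_pi.
  exact: free_evalD.
- move=> r x; rewrite -[x]quot_piE.
  have -> : r *: quot_pi (yh_ideal F d n) (repr x) =
            quot_pi (yh_ideal F d n) (r *: repr x) by rewrite quot_piZ.
  by rewrite !yh_chi_pi free_evalZ.
Qed.

HB.instance Definition _ :=
  GRing.PzSemiRing_isNonZero.Build ratyh ratyh_neq0.
HB.instance Definition _ :=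
  GRing.Lmodule_isLalgebra.Build K ratyh (@tensor_scaleAl _ _ _ _).
HB.instance Definition _ :=
  GRing.Lalgebra_isAlgebra.Build K ratyh (@tensor_scaleAr _ _ _ _).

Definition ratyh_t (j : 'I_n) : ratyh := pure laurent_incl 1 (yh_t F d j).
Definition ratyh_J (j : 'I_n) : ratyh := pure laurent_incl 1 (yh_J F d n j).

Definition jucys_murphy : set ratyh := range ratyh_t `|` range ratyh_J.

End RationalYokonumaHecke.

Arguments jucys_murphy : clear implicits.

Section Subalgebras.
Variables (K : comNzRingType) (A : algType K).

Definition is_subalgebra (S : set A) : Prop := GRing.subalg_closed (mem S).

Definition gen_subalgebra (X : set A) : set A := smallest is_subalgebra X.

Definition commutative_set (S : set A) : Prop :=
  forall x y, S x -> S y -> x * y = y * x.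

Definition maximal_commutative_subalgebra (S : set A) : Prop :=
  [/\ is_subalgebra S, commutative_set S &
    forall T : set A, is_subalgebra T -> commutative_set T ->
      S `<=` T -> T = S].

End Subalgebras.

(* Main.v *)
From HB Require Import structures.
Require Import Defs.
From mathcomp Require Import all_boot all_order all_algebra.
From mathcomp Require Import perm zify ring cyclic separable cyclotomic.
From mathcomp Require Import classical_sets reals complex monalg.

Set Implicit Arguments.
Unset Strict Implicit.
Unset Printing Implicit Defensive.

Import GRing.Theory.

(** The algebra has a faithful representation in which the Jucys-Murphy elements
    act by diagonal matrices with simple joint spectrum; both halves of the
    statement follow from that.

    Its basis consists of the standard [d]-tableaux with [n] boxes. A
    [d]-multipartition is encoded by its Maya diagrams: for each of the [d]
    colours a row of sites, each empty or holding a particle; adding a box on a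
    given diagonal makes one particle jump over the corresponding bond to the
    site on its right. A tableau is then a sequence of [n] jumps that is legal
    from the vacuum (all particles to the left). The element [t_j] acts on a
    tableau by [zeta ^ c], with [zeta] a primitive [d]-th root of unity and [c]
    the colour of the [j]-th jump, the element [J_j] acts by
    [q ^ (2 * diagonal)], and [g_i] mixes a tableau with the one whose [i]-th
    and [i+1]-st jumps are exchanged (Young's seminormal form). The [n] pairs of
    eigenvalues record all the jumps, so distinct tableaux have distinct
    eigenvalue systems, and by interpolation the matrix unit [E_TT] is the image
    of an element of the algebra of Jucys-Murphy elements
    ([path_idempotent]).

    Exchanges of commuting jumps connect any two tableaux with the same final
    diagram ([legal_linked]), so the image of the whole algebra contains [E_ST]
    for all such pairs ([path_matrix_unit]). The pairs number [d ^ n * n`!]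
    ([sum_legal_pairs]), because the operators [U] and [D] that add, resp. remove,
    a box in all possible ways satisfy [DU = UD + d]. On the other hand normal
    forms [t^a g_w] span the algebra, and there are [d ^ n * n`!] of them
    ([ratyh_span]). Hence the representation is faithful
    ([seminormal_inj]).

    Diagonal matrices commute, so the Jucys-Murphy elements commute. An element
    that commutes with all of them commutes with every [E_TT], so it acts by a
    diagonal matrix, that is by a combination of the [E_TT], and by faithfulness
    it is the corresponding combination of elements of the Jucys-Murphy
    algebra. *)

(** * Configurations of particles and paths *)

Section Hops.
Variables d n : nat.

(** After [n] jumps no particle has moved by more than [n] sites, hence
    [2n + 2] sites per colour are enough, the vacuum filling the first half. *)
Definition site := ('I_d * 'I_n.*2.+2)%type.
Definition hop := ('I_d * 'I_n.*2.+1)%type.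
Definition config := {ffun site -> bool}.

Definition lo (h : hop) : site := (h.1, widen_ord (leqnSn _) h.2).
Definition hi (h : hop) : site := (h.1, lift ord0 h.2).

Lemma lo_inj : injective lo.
Proof.
move=> [c k] [c' k'] e; have -> : c = c' by case: e.
by congr pair; apply: val_inj; apply: (congr1 (fun s : site => val s.2) e).
Qed.

Lemma hi_inj : injective hi.
Proof.
move=> [c k] [c' k'] e; have -> : c = c' by case: e.
by congr pair; apply: (@lift_inj _ ord0); apply: (congr1 snd e).
Qed.

Lemma hi_height h : val (hi h).2 = (val (lo h).2).+1.
Proof. by []. Qed.

Lemma lo_neq_hi h : lo h != hi h.
Proof. by apply/eqP => /(congr1 (fun s : site => val s.2)) /= /n_Sn. Qed.

Definition can_up (h : hop) (w : config) := w (lo h) && ~~ w (hi h).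
Definition can_down (h : hop) (w : config) := w (hi h) && ~~ w (lo h).
(** Exchanging the two ends of the bond describes the jump in either direction,
    and makes the map an involution on all configurations. *)
Definition jump (h : hop) (w : config) : config :=
  [ffun s => w (tperm (lo h) (hi h) s)].

(** Bonds without a common site, so that the jumps over them commute. *)
Definition apart (x y : hop) := [&& x != y, hi x != lo y & lo x != hi y].

Lemma apart_sym : symmetric apart.
Proof.
move=> x y; rewrite /apart eq_sym (eq_sym (hi x)) (eq_sym (lo x)).
by rewrite [(lo y != _) && _]andbC.
Qed.

Lemma apartPn x y : ~~ apart x y -> [\/ x = y, hi x = lo y | lo x = hi y].
Proof.
rewrite /apart; case: (x =P y) => [->|_]; first by constructor 1.
case: (hi x =P lo y) => [->|_]; first by constructor 2.
by case: (lo x =P hi y) => [->|_]; first by constructor 3.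
Qed.

Lemma jumpK h : involutive (jump h).
Proof. by move=> w; apply/ffunP => s; rewrite !ffunE tpermK. Qed.

Lemma can_down_jump h w : can_down h (jump h w) = can_up h w.
Proof. by rewrite /can_down /can_up !ffunE tpermL tpermR. Qed.

Lemma can_up_jump h w : can_up h (jump h w) = can_down h w.
Proof. by rewrite -can_down_jump jumpK. Qed.

Lemma apart_tperm x y s : apart x y ->
  (s == lo x) || (s == hi x) -> tperm (lo y) (hi y) s = s.
Proof.
move=> /and3P[xy hl lh] /orP[] /eqP ->; apply: tpermD.
- by rewrite (inj_eq lo_inj) eq_sym.
- by rewrite eq_sym.
- by rewrite eq_sym.
- by rewrite (inj_eq hi_inj) eq_sym.
Qed.

Lemma jump_site x y w s : apart x y -> (s == lo x) || (s == hi x) ->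
  jump y w s = w s.
Proof. by move=> xy xs; rewrite ffunE (apart_tperm xy xs). Qed.

Lemma can_up_apart x y w : apart x y -> can_up x (jump y w) = can_up x w.
Proof. by move=> xy; rewrite /can_up !(jump_site _ xy) ?eqxx ?orbT. Qed.

Lemma can_down_apart x y w : apart x y -> can_down x (jump y w) = can_down x w.
Proof. by move=> xy; rewrite /can_down !(jump_site _ xy) ?eqxx ?orbT. Qed.

Lemma jumpC x y w : apart x y -> jump x (jump y w) = jump y (jump x w).
Proof.
move=> xy; apply/ffunP => s; rewrite !ffunE; congr (w _).
have yx : apart y x by rewrite apart_sym.
have xE t := @apart_tperm x y t xy; have yE t := @apart_tperm y x t yx.
case: (tpermP (lo x) (hi x) s) => [->|->|sl sh].
- by rewrite !xE ?eqxx ?orbT // tpermL.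
- by rewrite !xE ?eqxx ?orbT // tpermR.
case: (tpermP (lo y) (hi y) s) => [_|_|yl yh].
- by rewrite yE ?eqxx ?orbT.
- by rewrite yE ?eqxx ?orbT.
- by rewrite tpermD //; apply/eqP => e; [case: sl|case: sh].
Qed.

(** The right ends of the two bonds are occupied and their left ends are empty,
    so no right end is a left end. *)
Lemma can_down_apart2 x y w :
  x != y -> can_down x w -> can_down y w -> apart x y.
Proof.
move=> xy /andP[xh xl] /andP[yh yl]; rewrite /apart xy /=.
apply/andP; split; apply/eqP => e.
  by move: yl; rewrite -e xh.
by move: xl; rewrite e yh.
Qed.

Fixpoint legal (w : config) (a : seq hop) : bool :=
  if a is h :: a' then can_up h w && legal (jump h w) a' else true.

Definition final (w : config) (a : seq hop) : config := foldl (fun v h => jump h v) w a.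

Lemma legal_cat w a b : legal w (a ++ b) = legal w a && legal (final w a) b.
Proof. by elim: a w => //= h a IH w; rewrite IH andbA. Qed.

Lemma final_cat w a b : final w (a ++ b) = final (final w a) b.
Proof. exact: foldl_cat. Qed.

Lemma legal_rcons w a h : legal w (rcons a h) = legal w a && can_up h (final w a).
Proof. by rewrite -cats1 legal_cat /= andbT. Qed.

Lemma final_rcons w a h : final w (rcons a h) = jump h (final w a).
Proof. by rewrite -cats1 final_cat. Qed.

Lemma legal_swap w a x y b : apart x y ->
  legal w (a ++ x :: y :: b) = legal w (a ++ y :: x :: b).
Proof.
move=> xy; rewrite !legal_cat /= (jumpC _ xy) can_up_apart 1?apart_sym //.
by rewrite can_up_apart //; congr (_ && _); rewrite andbCA.
Qed.

Lemma final_swap w a x y b : apart x y ->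
  final w (a ++ x :: y :: b) = final w (a ++ y :: x :: b).
Proof. by move=> xy; rewrite !final_cat /= jumpC // apart_sym. Qed.

Lemma legal_neq w a x y b : legal w (a ++ x :: y :: b) -> x != y.
Proof.
rewrite legal_cat /= => /and4P[_ /andP[xl _] yu _]; apply/eqP => e.
by move: yu; rewrite -e can_up_jump /can_down xl andbF.
Qed.

(** To hop twice over the same bond, a particle must be brought to its left
    end and another one removed from its right end in between; a single hop
    never does both. *)
Lemma legal_neq2 w a x y z b : legal w (a ++ x :: y :: z :: b) -> x != z.
Proof.
rewrite legal_cat /= => /and4P[_ xu yu /andP[zu _]]; apply/eqP => e.
move: zu; rewrite -{z}e; set v := final w a in xu yu *.
have [/can_up_apart ->|] := boolP (apart x y).
  by rewrite can_up_jump /can_down; case/andP: xu => ->; rewrite andbF.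
case/apartPn=> e.
- by move: yu; rewrite -e can_up_jump /can_down; case/andP: xu => ->; rewrite andbF.
- have lx : lo x != lo y by rewrite -e lo_neq_hi.
  have hx : lo x != hi y.
    apply/eqP => /(congr1 (fun s : site => val s.2))/eqP.
    by rewrite (hi_height y) -e (hi_height x) ltn_eqF // ltnS leqnSn.
  rewrite /can_up 2!ffunE [tperm (lo y) _ _]tpermD 1?eq_sym // tpermL.
  by case/andP: xu => _ /negbTE ->.
- have lx : hi x != lo y.
    apply/eqP => /(congr1 (fun s : site => val s.2))/eqP.
    by rewrite (hi_height x) e (hi_height y) eq_sym ltn_eqF // ltnS leqnSn.
  have hx : hi x != hi y by rewrite -e eq_sym lo_neq_hi.
  rewrite /can_up andbC 2!ffunE [tperm (lo y) _ _]tpermD 1?eq_sym // tpermR.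
  by case/andP: xu => ->.
Qed.

End Hops.

(** * Paths with a common end *)

Section Linked.
Variables d n : nat.
Local Notation hop := (hop d n).
Local Notation config := (config d n).

Inductive linked : seq hop -> seq hop -> Prop :=
| linked_refl a : linked a a
| linked_swap a x y b c :
    apart x y -> linked (a ++ y :: x :: b) c -> linked (a ++ x :: y :: b) c.

Lemma linked_trans a b c : linked a b -> linked b c -> linked a c.
Proof.
elim=> {a b} [//|a x y b e xy _ IH] /IH; exact: linked_swap.
Qed.

Lemma linked_rcons a b h : linked a b -> linked (rcons a h) (rcons b h).
Proof.
elim=> {a b} [a|a x y b e xy _ IH]; first exact: linked_refl.
by rewrite rcons_cat /=; apply: linked_swap xy _; rewrite -!rcons_cons -rcons_cat.
Qed.

Lemma linked_final w a b : linked a b -> final w a = final w b.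
Proof. by elim=> // a' x y b' c xy _ <-; apply: final_swap. Qed.

(** Any jump that can be undone at the end of a path may be taken to be the last
    one: if the last one is another, the two commute. *)
Lemma linked_last w a h : (forall x, ~~ can_down x w) ->
  legal w a -> can_down h (final w a) ->
  exists b, legal w (rcons b h) /\ linked a (rcons b h).
Proof.
move=> w0; elim/last_ind: a h => [|a z IH] h; first by rewrite (negbTE (w0 h)).
rewrite legal_rcons final_rcons => /andP[la uz] dh.
have [<-|zh] := eqVneq z h.
  by exists a; rewrite legal_rcons la uz; split=> //; apply: linked_refl.
have hz : apart h z.
  by apply: can_down_apart2 dh _; rewrite 1?eq_sym // can_down_jump.
rewrite (can_down_apart _ hz) in dh.
have [b [lb ab]] := IH _ la dh.
have e x y : rcons (rcons b x) y = b ++ [:: x; y] by rewrite -!cats1 -catA.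
have zh' : apart z h by rewrite apart_sym.
have fE := esym (linked_final w ab).
exists (rcons b z); split.
  by rewrite e (legal_swap _ _ _ zh') -e legal_rcons lb fE.
apply: linked_trans (linked_rcons z ab) _.
by rewrite !e; apply: linked_swap hz (linked_refl _).
Qed.

Lemma linked_size a b : linked a b -> size a = size b.
Proof. by elim=> // a' x y b' c xy _ <-; rewrite !size_cat. Qed.

(** By induction on the length: both paths are brought to the same last jump. *)
Lemma legal_linked w a b : (forall x, ~~ can_down x w) ->
  legal w a -> legal w b -> size a = size b -> final w a = final w b ->
  linked a b.
Proof.
move=> w0; elim/last_ind: b a => [|b y IH] a la.
  by move=> _ /size0nil -> _; apply: linked_refl.
rewrite legal_rcons final_rcons size_rcons => /andP[lb uy] sab fab.
have dy : can_down y (final w a) by rewrite fab can_down_jump.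
have [a' [la' aa']] := linked_last w0 la dy.
have sa := linked_size aa'; have fa := linked_final w aa'.
apply: linked_trans aa' (linked_rcons _ _); apply: IH => //.
- by move: la'; rewrite legal_rcons => /andP[].
- by apply: succn_inj; rewrite -sab sa size_rcons.
- apply: (can_inj (jumpK y)); by rewrite -fab fa final_rcons.
Qed.

End Linked.

(** * Counting the pairs of paths with a common end *)

Section Count.
Variables d n : nat.
Local Notation hop := (hop d n).
Local Notation config := (config d n).
Implicit Types (f g : config -> nat) (w v : config).

Definition vacuum : config := [ffun s : site d n => s.2 <= n].

Lemma vacuum_down h : ~~ can_down h vacuum.
Proof.
by rewrite /can_down !ffunE hi_height; apply/negP => /andP[/ltnW ->].
Qed.

(** In the vacuum, only the rightmost particle of a row has a free neighbour. *)
Lemma vacuum_up (x : hop) : can_up x vacuum -> val x.2 = n.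
Proof.
rewrite /can_up !ffunE hi_height -ltnNge ltnS => /andP[a b].
by apply/eqP; rewrite eqn_leq a.
Qed.

(** For functions on Young diagrams, the operators usually called U and D. *)
Definition up_op f w := \sum_h can_down h w * f (jump h w).
Definition down_op f w := \sum_h can_up h w * f (jump h w).

Lemma eq_up_op f g : f =1 g -> up_op f =1 up_op g.
Proof. by move=> fg w; apply: eq_bigr => h _; rewrite fg. Qed.

Lemma eq_down_op f g : f =1 g -> down_op f =1 down_op g.
Proof. by move=> fg w; apply: eq_bigr => h _; rewrite fg. Qed.

Lemma up_op_adjoint f g :
  \sum_w up_op f w * g w = \sum_w f w * down_op g w.
Proof.
under eq_bigr do rewrite big_distrl /=.
under [RHS]eq_bigr do rewrite big_distrr /=.
rewrite exchange_big [RHS]exchange_big; apply: eq_bigr => h _ /=.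
rewrite (reindex_inj (can_inj (jumpK h))); apply: eq_bigr => w _.
by rewrite can_down_jump jumpK -mulnA mulnCA.
Qed.

(** The differences of consecutive values telescope. *)
Lemma count_steps (u : nat -> bool) m :
  \sum_(k < m) (u k && ~~ u k.+1) + u m = \sum_(k < m) (u k.+1 && ~~ u k) + u 0.
Proof.
elim: m => [|m IH]; rewrite ?big_ord0 // !big_ord_recr /=.
move: IH; set a := \sum_(k < m) _; set b := \sum_(k < m) _.
by case: (u m); case: (u m.+1); case: (u 0) => /=; lia.
Qed.

(** Each colour contributes one to the difference, as its row of sites starts
    with a particle and ends with a hole. For partitions this says that there is
    one more addable box than there are removable boxes. *)
Lemma card_up_down w :
  (forall c, w (c, ord0) && ~~ w (c, ord_max)) ->
  \sum_h can_up h w = \sum_h can_down h w + d.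
Proof.
move=> wb; pose u (c : 'I_d) k := w (c, inord k).
have -> : \sum_h can_up h w = \sum_c \sum_(k < n.*2.+1) (u c k && ~~ u c k.+1).
  rewrite pair_bigA; apply: eq_bigr => -[c k] _ /=; rewrite /can_up /u.
  congr (nat_of_bool (w _ && ~~ w _)); congr pair; apply: val_inj => /=.
    by rewrite inordK // ltnS ltnW.
  by rewrite inordK // ltnS.
have -> : \sum_h can_down h w = \sum_c \sum_(k < n.*2.+1) (u c k.+1 && ~~ u c k).
  rewrite pair_bigA; apply: eq_bigr => -[c k] _ /=; rewrite /can_down /u.
  congr (nat_of_bool (w _ && ~~ w _)); congr pair; apply: val_inj => /=.
    by rewrite inordK // ltnS.
  by rewrite inordK // ltnS ltnW.
transitivity (\sum_c (\sum_(k < n.*2.+1) (u c k.+1 && ~~ u c k) + 1)); last first.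
  by rewrite big_split sum1_card card_ord.
apply: eq_bigr => c _.
have := count_steps (u c) n.*2.+1.
have -> : u c 0 = true.
  have /andP[w0 _] := wb c; rewrite -w0; congr (w (c, _)).
  by apply: val_inj; rewrite /= inordK.
have -> : u c n.*2.+1 = false.
  have /andP[_ /negbTE wm] := wb c; rewrite -wm; congr (w (c, _)).
  by apply: val_inj; rewrite /= inordK.
by rewrite addn0.
Qed.

(** Adding a box and removing a different one commute; on adjacent bonds neither
    order is possible. *)
Lemma jump_swap_terms h h' f w : h != h' ->
  can_up h w * (can_down h' (jump h w) * f (jump h' (jump h w))) =
  can_down h' w * (can_up h (jump h' w) * f (jump h (jump h' w))).
Proof.
move=> hh'; have [a|] := boolP (apart h h').
  have a' : apart h' h by rewrite apart_sym.
  by rewrite (can_down_apart _ a') (can_up_apart _ a) (jumpC _ a) mulnCA.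
case/apartPn=> e; first by rewrite e eqxx in hh'.
- have l : can_up h w && can_down h' (jump h w) = false.
    by rewrite /can_down -e [jump h w (hi h)]ffunE tpermR /can_up;
       case: (w (lo h)); rewrite ?andbF.
  have r : can_down h' w && can_up h (jump h' w) = false.
    by rewrite /can_up e [jump h' w (lo h')]ffunE tpermL /can_down;
       case: (w (hi h')); rewrite ?andbF.
  by rewrite !mulnA !mulnb l r.
- have l : can_up h w && can_down h' (jump h w) = false.
    by rewrite /can_down -e [jump h w (lo h)]ffunE tpermL /can_up;
       case: (w (hi h)); rewrite ?andbF.
  have r : can_down h' w && can_up h (jump h' w) = false.
    by rewrite /can_up e [jump h' w (hi h')]ffunE tpermR /can_down;
       case: (w (lo h')); rewrite ?andbF.
  by rewrite !mulnA !mulnb l r.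
Qed.

(** [DU - UD] is multiplication by the number of addable boxes minus the number
    of removable ones: all the other terms cancel. *)
Lemma down_up_op f w :
  down_op (up_op f) w + (\sum_h can_down h w) * f w =
  up_op (down_op f) w + (\sum_h can_up h w) * f w.
Proof.
pose T h h' := can_up h w * (can_down h' (jump h w) * f (jump h' (jump h w))).
pose S h h' := can_down h' w * (can_up h (jump h' w) * f (jump h (jump h' w))).
have -> : down_op (up_op f) w = \sum_h \sum_h' T h h'.
  by apply: eq_bigr => h _; rewrite big_distrr.
have -> : up_op (down_op f) w = \sum_h \sum_h' S h h'.
  by rewrite exchange_big; apply: eq_bigr => h _; rewrite big_distrr.
rewrite !big_distrl -!big_split; apply: eq_bigr => h _ /=.
rewrite (bigD1 h) //= [in RHS](bigD1 h) //= {1}/T {1}/S.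
rewrite can_down_jump can_up_jump !jumpK !mulnA !mulnb !andbb.
rewrite addnAC [in RHS]addnAC; congr (_ + _); first exact: addnC.
by apply: eq_bigr => h' hh'; apply: jump_swap_terms; rewrite eq_sym.
Qed.

Definition at_vacuum w : nat := w == vacuum.

Lemma down_op_vacuum w : down_op at_vacuum w = 0.
Proof.
apply: big1 => h _; rewrite /at_vacuum; case: eqP => [e|_]; last by rewrite muln0.
by have := vacuum_down h; rewrite -e can_down_jump => /negbTE ->.
Qed.

(** After [k] jumps no particle is further than [k] from its initial place, and
    so the ends of the rows are as in the vacuum as long as [k <= n]. *)
Lemma up_op_support k w : iter k up_op at_vacuum w != 0 ->
  forall s : site d n, (s.2 + k <= n -> w s) /\ (n + k < s.2 -> ~~ w s).
Proof.
elim: k w => [|k IH] w.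
  rewrite /= /at_vacuum; case: (w =P vacuum) => [-> _|_ /eqP//] s; rewrite ffunE !addn0.
  by split=> // sn; rewrite -ltnNge.
rewrite iterS sum_nat_eq0 negb_forall => /existsP[h].
rewrite implyTb muln_eq0 negb_or => /andP[dh] /IH v s.
have {}dh : can_down h w by case: can_down dh.
have /andP[wh /negbTE wl] := dh.
have [/eqP->|sl] := boolP (s == lo h).
  rewrite wl; split=> // sk; have [vh _] := v (hi h).
  by rewrite ffunE tpermR wl in vh; apply: vh; rewrite hi_height addSnnS.
have [/eqP->|sh] := boolP (s == hi h).
  rewrite wh; split=> // sk; have [_ vl] := v (lo h).
  rewrite ffunE tpermL wh in vl; apply: vl.
  by move: sk; rewrite hi_height addnS ltnS.
have [a b] := v s; rewrite ffunE tpermD 1?eq_sym // in a b.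
by split=> sk; [apply: a|apply: b]; lia.
Qed.

Lemma up_op_scale c f w : up_op (fun v => c * f v) w = c * up_op f w.
Proof. by rewrite /up_op big_distrr; apply: eq_bigr => h _; rewrite mulnCA. Qed.

Lemma down_op_scale c f w : down_op (fun v => c * f v) w = c * down_op f w.
Proof. by rewrite /down_op big_distrr; apply: eq_bigr => h _; rewrite mulnCA. Qed.

Lemma down_up_step k w (f := iter k up_op at_vacuum) : k <= n ->
  up_op (down_op f) w = d * k * f w ->
  down_op (up_op f) w = d * k.+1 * f w.
Proof.
move=> kn ud; have := down_up_op f w; rewrite ud => e.
have [f0|/up_op_support supp] := eqVneq (f w) 0.
  by move: e; rewrite f0 !muln0 !addn0.
apply: (@addIn ((\sum_h can_down h w) * f w)); rewrite e mulnS.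
rewrite (@card_up_down w) => [|c]; first by rewrite !mulnDl; lia.
by have [a _] := supp (c, ord0); have [_ b] := supp (c, ord_max);
   rewrite a //= b //= -addnn ltnS leq_add2l.
Qed.

Lemma down_up_vacuum k w : k <= n ->
  down_op (iter k.+1 up_op at_vacuum) w = d * k.+1 * iter k up_op at_vacuum w.
Proof.
elim: k w => [|k IH] w kn.
  apply: (@down_up_step 0) => //; rewrite muln0 mul0n (eq_up_op down_op_vacuum).
  by apply: big1 => h _; rewrite muln0.
apply: (@down_up_step k.+1) => //.
by rewrite (eq_up_op (IH^~ (ltnW kn))) up_op_scale.
Qed.

(** The [k] operators [D] are moved through the operators [U]; every step brings
    a factor [d * k], and [D] kills the vacuum. *)
Lemma down_up_iter k : k <= n ->
  iter k down_op (iter k up_op at_vacuum) vacuum = d ^ k * k`!.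
Proof.
elim: k => [|k IH] kn; first by rewrite /at_vacuum /= eqxx.
have scale m c f g : f =1 (fun v => c * g v) ->
    iter m down_op f =1 (fun v => c * iter m down_op g v).
  move=> fg; elim: m => [//|m IHm] v.
  by rewrite iterS (eq_down_op IHm) down_op_scale.
rewrite iterSr (scale _ _ _ _ (fun w => down_up_vacuum w (ltnW kn))).
by rewrite IH ?(ltnW kn) // factS expnS; lia.
Qed.

Lemma sum_legal_tuples m g w :
  \sum_(a : m.-tuple hop) legal w a * g (final w a) = iter m down_op g w.
Proof.
elim: m w => [|m IH] w.
  rewrite (big_pred1 [tuple]) ?mul1n // => a; symmetry; exact/eqP/tuple0.
rewrite iterS /down_op; under [RHS]eq_bigr do rewrite -IH big_distrr.
rewrite pair_bigA (reindex (fun p : hop * m.-tuple hop => [tuple of p.1 :: p.2])).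
  by apply: eq_bigr => -[h a] _ /=; rewrite -mulnb mulnA.
exists (fun a => (thead a, [tuple of behead a])) => [[h a] _|a _] /=.
  by rewrite theadE; congr pair; apply: val_inj.
by rewrite [RHS]tuple_eta.
Qed.

(** This is the identity [\sum_lambda f_lambda ^ 2 = d ^ n * n`!], with
    [f_lambda] the number of standard tableaux of shape [lambda]: grouping the
    pairs by their end [v], the sum is [D^n U^n] evaluated at the vacuum, as
    [U^n] counts the paths from the vacuum to [v]. *)
Lemma sum_legal_pairs :
  \sum_(a : n.-tuple hop) \sum_(b : n.-tuple hop)
     [&& legal vacuum a, legal vacuum b & final vacuum a == final vacuum b]
  = d ^ n * n`!.
Proof.
rewrite -(down_up_iter (leqnn n)) -sum_legal_tuples; apply: eq_bigr => a _.
set v := final _ a; have adj : \sum_w at_vacuum w *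
    iter n down_op (fun u => v == u) w = iter n up_op at_vacuum v.
  have sum_at (f : config -> nat) u : \sum_w (u == w) * f w = f u.
    rewrite (bigD1 u) //= eqxx mul1n big1 ?addn0 // => w.
    by rewrite eq_sym => /negbTE ->.
  have adjoint m f g : \sum_w iter m up_op f w * g w =
      \sum_w f w * iter m down_op g w.
    elim: m f => // m IH f; rewrite iterSr IH.
    by rewrite up_op_adjoint.
  rewrite -adjoint; under eq_bigr do rewrite mulnC.
  exact: sum_at.
have -> : iter n up_op at_vacuum v =
    iter n down_op (fun u => v == u : nat) vacuum.
  rewrite -adj (bigD1 vacuum) //= {1}/at_vacuum eqxx mul1n big1 ?addn0 // => w.
  by rewrite /at_vacuum => /negbTE ->.
rewrite -sum_legal_tuples big_distrr; apply: eq_bigr => b _ /=.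
by rewrite -!mulnb.
Qed.
End Count.

(** * Spanning by normal forms *)

Section Span.
Local Open Scope ring_scope.
Variables (K : comNzRingType) (A : algType K).
Implicit Types (s t : seq A) (x y : A).

Definition in_span s x : Prop :=
  exists c : nat -> K, x = \sum_(i < size s) c i *: s`_i.

Lemma in_span_mem s x : x \in s -> in_span s x.
Proof.
move=> xs; exists (fun i => (i == index x s)%:R).
have xi : (index x s < size s)%N by rewrite index_mem.
rewrite (bigD1 (Ordinal xi)) //= eqxx scale1r nth_index // big1 ?addr0 // => i.
by rewrite -val_eqE /= => /negbTE ->; rewrite scale0r.
Qed.

Lemma in_span0 s : in_span s 0.
Proof. by exists (fun=> 0); rewrite big1 // => i _; rewrite scale0r. Qed.

Lemma in_spanD s x y : in_span s x -> in_span s y -> in_span s (x + y).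
Proof.
move=> [c ->] [c' ->]; exists (fun i => c i + c' i).
by rewrite -big_split; apply: eq_bigr => i _; rewrite scalerDl.
Qed.

Lemma in_spanZ s k x : in_span s x -> in_span s (k *: x).
Proof.
move=> [c ->]; exists (fun i => k * c i).
by rewrite scaler_sumr; apply: eq_bigr => i _; rewrite scalerA.
Qed.

Lemma in_span_sum s (I : Type) (r : seq I) (P : pred I) (F : I -> A) :
  (forall i, P i -> in_span s (F i)) -> in_span s (\sum_(i <- r | P i) F i).
Proof.
move=> sF; elim/big_rec: _ => [|i x Pi]; first exact: in_span0.
by apply: in_spanD; apply: sF.
Qed.

Lemma in_spanM s t x y : in_span s x -> y \in t ->
  in_span [seq a * b | a <- s, b <- t] (x * y).
Proof.
move=> [c ->] yt; rewrite mulr_suml; apply: in_span_sum => i _.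
rewrite -scalerAl; apply/in_spanZ/in_span_mem/allpairsP.
by exists (s`_i, y); rewrite mem_nth.
Qed.

Lemma in_span_mulr s y : (forall x, x \in s -> in_span s (x * y)) ->
  forall x, in_span s x -> in_span s (x * y).
Proof.
move=> sy x [c ->]; rewrite mulr_suml; apply: in_span_sum => i _.
by rewrite -scalerAl; apply/in_spanZ/sy/mem_nth.
Qed.

Lemma in_span_mulX s y k x :
  (forall x, in_span s x -> in_span s (x * y)) ->
  in_span s x -> in_span s (x * y ^+ k).
Proof.
move=> sy sx; elim: k => [|k IH]; first by rewrite mulr1.
by rewrite exprSr mulrA; apply: sy.
Qed.

End Span.

Section NormalForm.
Local Open Scope ring_scope.
Variables (K : comNzRingType) (A : algType K) (d n : nat) (z z' : K).
Variables (g t : nat -> A).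
(** [g_(m-1) ... g_(m-l)]. In the symmetric group on [0, ..., m] these products
    are the shortest representatives of the right cosets of the stabiliser of
    [m]. *)
Fixpoint descent m l : A :=
  if l is l'.+1 then descent m l' * g (m - l) else 1.

(** Products over [k < m] of [t_k^a g_(k-1) ... g_(k-l)] with [a < d] and
    [l <= k]: the elements [t^a g_w] with [w] decomposed along the chain of
    symmetric groups. *)
Fixpoint normal_forms m : seq A :=
  if m is m'.+1 then
    [seq b * u | b <- normal_forms m',
                 u <- [seq t m' ^+ a * descent m' l | a <- iota 0 d, l <- iota 0 m]]
  else [:: 1].

Lemma size_normal_forms m : size (normal_forms m) = (d ^ m * m`!)%N.
Proof.
elim: m => [//|m IH]; apply: etrans (size_allpairs _ _ _) _.
by rewrite size_allpairs !size_iota IH expnS factS; lia.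
Qed.

Hypothesis ggC : forall i j, (i.+1 < j)%N -> (j.+1 < n)%N -> g i * g j = g j * g i.
Hypothesis ggB : forall i, (i.+2 < n)%N ->
  g i * g i.+1 * g i = g i.+1 * g i * g i.+1.
Hypothesis ttC : forall i j, (i < n)%N -> (j < n)%N -> t i * t j = t j * t i.
Hypothesis tgC : forall i j, (i.+1 < n)%N -> (j < n)%N -> j != i -> j != i.+1 ->
  t j * g i = g i * t j.
Hypothesis tgL : forall i, (i.+1 < n)%N -> t i * g i = g i * t i.+1.
Hypothesis tgR : forall i, (i.+1 < n)%N -> t i.+1 * g i = g i * t i.
Hypothesis td : forall j, (j < n)%N -> t j ^+ d = 1.
Hypothesis gg : forall i, (i.+1 < n)%N -> g i * g i =
  1 + z *: (z' *: (\sum_(0 <= s < d) t i ^+ s * t i.+1 ^+ (d - s)) * g i).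

(** A generator that passes to the left of a descent keeps its index, or has it
    lowered by one; only [t_(m-l)] becomes [t_m]. *)
Lemma descent_gC m l j : (m < n)%N -> (j.+1 < m - l)%N ->
  descent m l * g j = g j * descent m l.
Proof.
move=> mn; elim: l => [|l IH] jl; first by rewrite mul1r mulr1.
have jl' : (j.+1 < m - l)%N by lia.
by rewrite /= -mulrA -ggC ?mulrA ?IH //; lia.
Qed.

Lemma descent_tC m l j : (m < n)%N -> (l <= m)%N -> (j < m - l)%N ->
  descent m l * t j = t j * descent m l.
Proof.
move=> mn; elim: l => [|l IH] lm jl; first by rewrite mul1r mulr1.
by rewrite /= -mulrA -tgC ?mulrA ?IH //; lia.
Qed.

Lemma descent_t m l : (m < n)%N -> (l <= m)%N ->
  descent m l * t (m - l) = t m * descent m l.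
Proof.
move=> mn; elim: l => [|l IH] lm; first by rewrite subn0 mul1r mulr1.
have ml : (m - l = (m - l.+1).+1)%N by lia.
by rewrite /= -mulrA -tgR -?ml ?mulrA ?IH //; lia.
Qed.

Lemma descent_tS m l j : (m < n)%N -> (l <= m)%N -> (m - l <= j < m)%N ->
  descent m l * t j.+1 = t j * descent m l.
Proof.
move=> mn; elim: l => [|l IH] lm jl; first lia.
rewrite /= -mulrA; have [->|jE] := eqVneq j (m - l.+1)%N.
  by rewrite -tgL ?mulrA ?descent_tC //; lia.
by rewrite -tgC ?mulrA ?IH //; lia.
Qed.

Lemma descent_gS m l j : (m < n)%N -> (l <= m)%N -> (m - l <= j)%N ->
  (j.+1 < m)%N -> descent m l * g j.+1 = g j * descent m l.
Proof.
move=> mn; elim: l => [|l IH] lm jl jm; first lia.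
have [jE|jE] := eqVneq j (m - l.+1)%N; last first.
  rewrite /= -mulrA ggC; [|lia|lia].
  by rewrite mulrA IH ?mulrA //; lia.
case: l IH lm jl jE => [|l] _ lm jl jE; first lia.
have jS : (m - l.+1)%N = j.+1 by lia.
rewrite /= jS -jE -!mulrA (mulrA (g j.+1)) -ggB; last lia.
by rewrite !mulrA descent_gC //; lia.
Qed.

Hypothesis d_gt0 : (0 < d)%N.

Local Notation S m := (in_span (normal_forms m)).

Lemma normal_formsS m b a l : (m < n)%N -> (l <= m)%N -> S m b ->
  S m.+1 (b * (t m ^+ a * descent m l)).
Proof.
move=> mn lm Sb; apply: in_spanM Sb _; apply/allpairsP.
exists ((a %% d)%N, l); split; first by rewrite mem_iota add0n ltn_mod.
  by rewrite mem_iota add0n ltnS.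
rewrite {1}(divn_eq a d) exprD mulnC exprM.
by rewrite td // expr1n mul1r.
Qed.

Lemma normal_forms1 m : (m <= n)%N -> S m 1.
Proof.
elim: m => [|m IH] mn; first exact/in_span_mem/mem_head.
by have := @normal_formsS m 1 0 0 mn isT (IH (ltnW mn)); rewrite !mulr1.
Qed.

(** Multiplying [b t_m^a g_(m-1) ... g_(m-l)] by a generator on the right, one of
    three things happens: the generator passes to the left, where it is absorbed
    by [b] or by [t_m^a]; or it prolongs the descent; or it equals the last
    factor [g_(m-l)], and then the quadratic relation shortens the descent or
    leaves it, the idempotent [e] passing to the left. *)
Lemma normal_forms_closed m : (m <= n)%N ->
  (forall j, (j < m)%N -> forall x, S m x -> S m (x * t j)) /\
  (forall j, (j.+1 < m)%N -> forall x, S m x -> S m (x * g j)).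
Proof.
elim: m => [//|m IH] mn; have [IHt IHg] := IH (ltnW mn).
have tX i j a : (i < n)%N -> (j < n)%N -> t i ^+ a * t j = t j * t i ^+ a.
  by move=> ni nj; apply/commr_sym/commrX/commr_sym/ttC.
have split_nf x : x \in normal_forms m.+1 ->
    exists b a l, [/\ S m b, (l <= m)%N & x = b * (t m ^+ a * descent m l)].
  case/allpairsP=> -[b u] [Bb /allpairsP[[a l] [_ hl uE]] ->].
  exists b, a, l; split; first exact: in_span_mem.
    by rewrite mem_iota add0n ltnS in hl.
  by rewrite [u]uE.
split=> j jm; apply: in_span_mulr => _ /split_nf[b [a [l [Sb lm ->]]]].
  have [jl|jl] := ltnP j (m - l).
    rewrite -!mulrA descent_tC // [t m ^+ a * _]mulrA tX //; last lia.
    rewrite -mulrA mulrA; apply: normal_formsS => //.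
    by apply: IHt => //; lia.
  have [->|jl'] := eqVneq j (m - l)%N.
    by rewrite -!mulrA descent_t // [t m ^+ a * _]mulrA -exprSr; apply: normal_formsS.
  case: j jm jl jl' => [|j] jm jl jl'; first lia.
  rewrite -!mulrA descent_tS //; last lia.
  rewrite [t m ^+ a * _]mulrA tX //; last lia.
  rewrite -mulrA mulrA; apply: normal_formsS => //.
  by apply: IHt => //; lia.
have tgX i : (i.+1 < m)%N -> t m ^+ a * g i = g i * t m ^+ a.
  by move=> im; apply/commr_sym/commrX/commr_sym/tgC; lia.
have [jl|jl] := ltnP j.+1 (m - l).
  rewrite -!mulrA descent_gC // [t m ^+ a * _]mulrA tgX; last lia.
  by rewrite -mulrA mulrA; apply: normal_formsS => //; apply: IHg => //; lia.
have [jE|jl'] := eqVneq j.+1 (m - l)%N.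
  have -> : j = (m - l.+1)%N by lia.
  by rewrite -!mulrA -[_ * g _]/(descent m l.+1); apply: normal_formsS => //; lia.
have [jE|jE] := eqVneq j (m - l)%N; last first.
  case: j jm jl jl' jE => [|j] jm jl jl' jE; first lia.
  rewrite -!mulrA descent_gS //; try lia.
  rewrite [t m ^+ a * _]mulrA tgX; last lia.
  by rewrite -mulrA mulrA; apply: normal_formsS => //; apply: IHg => //; lia.
case: l lm jl jl' jE => [|l] lm jl jl' jE; first lia.
have dE : descent m l.+1 = descent m l * g j by rewrite jE.
rewrite dE -!mulrA gg; last lia.
rewrite !mulrDr !mulr1; apply: in_spanD; first by apply: normal_formsS => //; lia.
rewrite -!scalerAr -!scalerAl -!scalerAr; do 2 apply: in_spanZ.
rewrite mulr_suml !mulr_sumr; apply: in_span_sum => s _.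
have dt : descent m l * (t j ^+ s * t j.+1 ^+ (d - s)) =
          t j ^+ s * t m ^+ (d - s) * descent m l.
  have jl1 : j.+1 = (m - l)%N by lia.
  have dc : GRing.comm (descent m l) (t j ^+ s).
    by apply/commrX/descent_tC => //; lia.
  rewrite mulrA jl1 dc -!mulrA; congr (_ * _).
  elim: (d - s)%N => [|e IHe]; first by rewrite mul1r mulr1.
  by rewrite exprSr mulrA IHe -mulrA descent_t -?mulrA ?exprSr ?mulrA //; lia.
rewrite [descent m l * _]mulrA dt -!mulrA [t m ^+ a * _]mulrA.
have tc : t m ^+ a * t j ^+ s = t j ^+ s * t m ^+ a.
  by apply/commrX/commr_sym/commrX/ttC => //; lia.
rewrite tc.
rewrite -!mulrA [t m ^+ a * _]mulrA -exprD (mulrA b).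
rewrite -dE; apply: normal_formsS => //.
by apply: in_span_mulX => // x; apply: IHt; lia.
Qed.

End NormalForm.

(** * Coefficients of the seminormal form *)

Section Coefficients.
Local Open Scope ring_scope.
Variables (K : fieldType) (d n : nat) (q : K).
Hypothesis q_neq0 : q != 0.
Hypothesis q_inj : injective (fun k => q ^+ k).
Local Notation hop := (hop d n).
Implicit Types x y z : hop.

(** The diagonal of a jump is counted from the only one available in the vacuum,
    number [n]. *)
Definition content x : K := q ^+ x.2.*2 / q ^+ n.*2.

Definition diag_coef x y : K :=
  if x.1 == y.1 then (q - q^-1) * content y / (content y - content x) else 0.

(** Only the product [swap_coef x y * swap_coef y x] matters ([swap_coefM]). It
    is put in one of the two factors, so that no square root is needed, and both
    are zero when the exchange of two legal consecutive jumps is illegal. *)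
Definition swap_coef x y : K :=
  if apart x y then
    if (x.2 < y.2)%N then 1 + diag_coef x y * diag_coef y x else 1
  else 0.

Lemma content_shift x y k l :
  (q ^+ k.*2 * content x == q ^+ l.*2 * content y) = (x.2 + k == y.2 + l)%N.
Proof.
have u : q ^+ n.*2 != 0 by rewrite expf_neq0.
rewrite /content !mulrA (inj_eq (mulIf (invr_neq0 u))) -!exprD.
by rewrite (inj_eq q_inj) -!doubleD (inj_eq double_inj) addnC (addnC l).
Qed.

Lemma hop_neq x y : x != y -> x.1 = y.1 -> x.2 != y.2 :> nat.
Proof.
move=> xy c; apply: contra_neq xy; case: x y c => [c k] [c' k'] /= -> /val_inj ->.
by [].
Qed.

Lemma content_eq x y : (content x == content y) = (x.2 == y.2 :> nat).
Proof. by have := content_shift x y 0 0; rewrite !mul1r !addn0. Qed.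

Lemma content_inj x y : x != y -> x.1 = y.1 -> content y - content x != 0.
Proof. by move=> xy /(hop_neq xy); rewrite subr_eq0 content_eq eq_sym. Qed.

Lemma diag_coefD x y : x != y ->
  diag_coef x y + diag_coef y x = if x.1 == y.1 then q - q^-1 else 0.
Proof.
move=> xy; rewrite /diag_coef [y.1 == _]eq_sym.
case: eqP => [c|]; last by rewrite addr0.
have nz := content_inj xy c.
rewrite -[content x - content y]opprB invrN; set a := content x in nz *.
by set b := content y in nz *; field; rewrite nz q_neq0.
Qed.

Lemma diag_coef_content x y : x != y ->
  diag_coef x y * content x + diag_coef y x * content y = 0.
Proof.
move=> xy; rewrite /diag_coef [y.1 == _]eq_sym.
case: eqP => [c|]; last by rewrite !mul0r addr0.
have nz := content_inj xy c.
rewrite -[content x - content y]opprB invrN; set a := content x in nz *.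
by set b := content y in nz *; field; rewrite nz q_neq0.
Qed.

(** When [g_1 g_2 g_1] and [g_2 g_1 g_2] are applied to the path [x, y, z], these
    are the coefficients of [y, x, z], without the factor [swap_coef x y]; the
    mirror identity below comes from [x, z, y], and the coefficients of the other
    paths agree as a consequence. *)
Lemma diag_coef_braid x y z : x != y -> y != z -> x != z ->
  diag_coef x z * diag_coef y x + diag_coef x y * diag_coef y z =
  diag_coef y z * diag_coef x z.
Proof.
move=> xy yz xz; rewrite /diag_coef ![y.1 == x.1]eq_sym.
case: (x.1 =P y.1) => [cxy|cxy]; last first.
  case: (y.1 =P z.1) => [cyz|_]; case: (x.1 =P z.1) => [cxz|_];
    rewrite ?(mulr0, mul0r, addr0) //.
  by case: cxy; rewrite cxz cyz.
rewrite cxy; case: (y.1 =P z.1) => [cyz|_]; last by rewrite !(mulr0, mul0r, addr0).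
have := content_inj xz (etrans cxy cyz); have := content_inj yz cyz.
have := content_inj xy cxy.
rewrite -[content x - content y]opprB invrN.
move: (content x) (content y) (content z) => a b c h1 h2 h3.
by field; rewrite h1 h2 h3 q_neq0.
Qed.

Lemma diag_coef_braid' x y z : x != y -> y != z -> x != z ->
  diag_coef x z * diag_coef z y + diag_coef y z * diag_coef x y =
  diag_coef x y * diag_coef x z.
Proof.
move=> xy yz xz; rewrite /diag_coef ![z.1 == y.1]eq_sym.
case: (y.1 =P z.1) => [cyz|cyz]; last first.
  case: (x.1 =P y.1) => [cxy|_]; case: (x.1 =P z.1) => [cxz|_];
    rewrite ?(mulr0, mul0r, addr0) //.
  by case: cyz; rewrite -cxz -cxy.
rewrite -cyz; case: (x.1 =P y.1) => [cxy|_]; last by rewrite !(mulr0, mul0r, addr0).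
have := content_inj xz (etrans cxy cyz); have := content_inj yz cyz.
have := content_inj xy cxy.
rewrite -[content y - content z]opprB invrN.
move: (content x) (content y) (content z) => a b c h1 h2 h3.
by field; rewrite h1 h2 h3 q_neq0.
Qed.

Lemma diag_coefM x y : x != y -> x.1 = y.1 ->
  1 + diag_coef x y * diag_coef y x =
  (q ^+ 2 * content x - content y) * (q ^+ 2 * content y - content x)
    / ((content y - content x) ^+ 2 * - q ^+ 2).
Proof.
move=> xy c; rewrite /diag_coef [y.1 == _]eq_sym c eqxx.
have nz := content_inj xy c.
rewrite -[content x - content y]opprB invrN; set a := content x in nz *.
by set b := content y in nz *; field; rewrite oppr_eq0 expf_neq0 ?nz ?q_neq0.
Qed.

Lemma apart_color x y : x.1 != y.1 -> apart x y.
Proof.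
move=> c; apply/and3P; split; apply: contra_neq c => e; exact: (congr1 fst e).
Qed.

(** For distinct bonds of the same colour, being adjacent means that the contents
    differ by a factor [q ^+ 2] or [q ^- 2], and these are the zeros of the
    numerator in [diag_coefM]. *)
Lemma diag_coefM_eq0 x y : x != y ->
  (1 + diag_coef x y * diag_coef y x == 0) = ~~ apart x y.
Proof.
move=> xy; have [c|c] := eqVneq x.1 y.1; last first.
  by rewrite /diag_coef (negbTE c) mul0r addr0 oner_eq0 apart_color.
rewrite (diag_coefM xy c) mulf_eq0 invr_eq0.
rewrite [X in _ || X]negbTE; last first.
  by rewrite mulf_neq0 ?oppr_eq0 ?expf_neq0 ?content_inj.
rewrite mulf_eq0 !subr_eq0 orbF.
have := content_shift x y 1 0; have := content_shift y x 1 0.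
rewrite !mul1r !addn0 !addn1 => -> ->.
rewrite /apart xy /= negb_and !negbK; congr (_ || _).
  apply/eqP/eqP => [e|/(congr1 (fun s : site d n => val s.2))//].
  by congr pair => //; apply: val_inj.
apply/eqP/eqP => [e|/(congr1 (fun s : site d n => val s.2))//].
by congr pair => //; apply: val_inj.
Qed.

Lemma swap_coefM x y : x != y ->
  swap_coef x y * swap_coef y x = 1 + diag_coef x y * diag_coef y x.
Proof.
move=> xy; rewrite /swap_coef [apart y x]apart_sym.
have [_|axy] := boolP (apart x y); last first.
  by symmetry; apply/eqP; rewrite mulr0 diag_coefM_eq0.
rewrite [diag_coef y x * _]mulrC; case: ltngtP => [||e]; rewrite ?mulr1 ?mul1r //.
have c : x.1 != y.1 by apply/negP => /eqP/(hop_neq xy); rewrite e eqxx.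
by rewrite /diag_coef (negbTE c) mul0r addr0.
Qed.

Lemma swap_coef_eq0 x y : x != y -> (swap_coef x y == 0) = ~~ apart x y.
Proof.
move=> xy; rewrite /swap_coef; case: ifP => a; last by rewrite eqxx.
by case: ifP; rewrite ?oner_eq0 // diag_coefM_eq0 // a.
Qed.

Lemma coef_braid m (A B : 'M[K]_m) (v : hop -> hop -> hop -> 'cV[K]_m) x y z :
  (forall x y z,
     A *m v x y z = diag_coef x y *: v x y z + swap_coef x y *: v y x z) ->
  (forall x y z,
     B *m v x y z = diag_coef y z *: v x y z + swap_coef y z *: v x z y) ->
  x != y -> y != z -> x != z ->
  A *m (B *m (A *m v x y z)) = B *m (A *m (B *m v x y z)).
Proof.
move=> Av Bv xy yz xz; do 6 rewrite ?mulmxDr -?scalemxAr ?Av ?Bv.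
have /eqP h1 := diag_coef_braid' xy yz xz.
have /eqP h2 := diag_coef_braid xy yz xz.
have /eqP h3 := swap_coefM xy; have /eqP h4 := swap_coefM yz.
rewrite -subr_eq0 in h1; rewrite -subr_eq0 in h2.
rewrite -subr_eq0 in h3; rewrite -subr_eq0 in h4.
apply/colP => k; rewrite !mxE; apply/eqP; rewrite -subr_eq0; apply/eqP.
(* the difference of the two sides, as a combination of the four identities *)
transitivity (
   (swap_coef x y * swap_coef y x - (1 + diag_coef x y * diag_coef y x))
     * diag_coef x z * v x y z k 0
   - (swap_coef y z * swap_coef z y - (1 + diag_coef y z * diag_coef z y))
     * diag_coef x z * v x y z k 0
   + (diag_coef x z * diag_coef y x + diag_coef x y * diag_coef y z
      - diag_coef y z * diag_coef x z)
     * (diag_coef x y * v x y z k 0 + swap_coef x y * v y x z k 0)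
   - (diag_coef x z * diag_coef z y + diag_coef y z * diag_coef x y
      - diag_coef x y * diag_coef x z)
     * (diag_coef y z * v x y z k 0 + swap_coef y z * v x z y k 0)).
  by ring.
by rewrite (eqP h1) (eqP h2) (eqP h3) (eqP h4) !mul0r subrr addr0 subr0.
Qed.

Lemma coef_quadratic m (A : 'M[K]_m) (v : hop -> hop -> 'cV[K]_m) x y :
  (forall x y, A *m v x y = diag_coef x y *: v x y + swap_coef x y *: v y x) ->
  x != y ->
  A *m (A *m v x y) = v x y
    + (q - q^-1) *: ((x.1 == y.1)%:R *: (A *m v x y)).
Proof.
move=> Av xy; do 3 rewrite ?mulmxDr -?scalemxAr ?Av.
have h : (q - q^-1) * (x.1 == y.1)%:R = diag_coef x y + diag_coef y x.
  by rewrite diag_coefD //; case: ifP; rewrite ?mulr1 ?mulr0.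
rewrite scalerA h; have h1 := swap_coefM xy.
apply/colP => k; rewrite !mxE.
rewrite !mulrDr !mulrA h1; ring.
Qed.

(** This is [g_i J_i g_i = J_(i+1)] on a vector, once [J_i] is known to act by the
    content of the [i]-th jump. *)
Lemma coef_content m (A : 'M[K]_m) (v : hop -> hop -> 'cV[K]_m) x y :
  (forall x y, A *m v x y = diag_coef x y *: v x y + swap_coef x y *: v y x) ->
  x != y ->
  A *m (diag_coef x y *: (content x *: v x y)
        + swap_coef x y *: (content y *: v y x)) = content y *: v x y.
Proof.
move=> Av xy; do 3 rewrite ?mulmxDr -?scalemxAr ?Av.
have /eqP h1 := swap_coefM xy; have /eqP h2 := diag_coef_content xy.
rewrite -subr_eq0 in h1.
apply/colP => k; rewrite !mxE; apply/eqP; rewrite -subr_eq0; apply/eqP.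
(* the difference of the two sides, as a combination of the two identities *)
transitivity (
  (swap_coef x y * swap_coef y x - (1 + diag_coef x y * diag_coef y x))
     * content y * v x y k 0
  + (diag_coef x y * content x + diag_coef y x * content y)
     * (diag_coef x y * v x y k 0 + swap_coef x y * v y x k 0)); first by ring.
by rewrite (eqP h1) (eqP h2) !mul0r addr0.
Qed.

End Coefficients.

(** * The seminormal matrices *)

Section Representation.
Local Open Scope ring_scope.
Variables (K : fieldType) (d n : nat) (q : K).
Hypothesis d_gt0 : (0 < d)%N.
Local Notation hop := (hop d n).
Local Notation diag_coef := (@diag_coef K d n q).
Local Notation swap_coef := (@swap_coef K d n q).
Local Notation content := (@content K d n q).
Implicit Types (x y : hop) (s : seq hop).

Definition paths : seq (seq hop) :=
  [seq val a | a <- enum [pred a : n.-tuple hop | legal (vacuum d n) a]].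

Lemma paths_uniq : uniq paths.
Proof.
by rewrite map_inj_uniq ?enum_uniq // => a b /val_inj.
Qed.

Lemma mem_paths s : (s \in paths) = (size s == n) && legal (vacuum d n) s.
Proof.
apply/mapP/andP => [[a]|[ss ls]].
  by rewrite mem_enum => la ->; rewrite size_tuple.
by exists (Tuple ss); rewrite // mem_enum.
Qed.

Lemma paths_gt0 : (0 < size paths)%N.
Proof.
rewrite -has_predT; have := sum_legal_pairs d n; case: hasP => // no_path.
rewrite big1 => [/esym/eqP|a _].
  by rewrite gtn_eqF // muln_gt0 expn_gt0 d_gt0 fact_gt0.
apply: big1 => b _; case: legal (mem_paths a) => //.
by rewrite size_tuple eqxx => pa; case: no_path; exists (val a).
Qed.

(* Of the form m.+1, so that matrices of this size form a nontrivial ring. *)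
Local Notation M := (size paths).-1.+1.

Lemma size_paths : M = size paths. Proof. exact: prednK paths_gt0. Qed.

Definition path_index s : 'I_M := inord (index s paths).
Definition path_of (i : 'I_M) : seq hop := nth [::] paths i.

Lemma path_ofK : cancel path_of path_index.
Proof.
move=> i; have li : (i < size paths)%N by rewrite -[X in (_ < X)%N]size_paths.
by rewrite /path_index /path_of index_uniq ?paths_uniq // inord_val.
Qed.

Lemma path_indexK s : s \in paths -> path_of (path_index s) = s.
Proof.
move=> sp; rewrite /path_of inordK ?nth_index //.
by rewrite size_paths index_mem.
Qed.

Lemma path_of_mem i : path_of i \in paths.
Proof. by apply/mem_nth/(leq_trans (ltn_ord i)); rewrite size_paths. Qed.

(** Illegal sequences give the zero vector; the action of the generators can then
    be written without asking whether an exchange is legal. *)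
Definition path_vect s : 'cV[K]_M :=
  if s \in paths then delta_mx (path_index s) 0 else 0.

Definition path_mx (f : seq hop -> 'cV[K]_M) : 'M[K]_M :=
  \matrix_(i, j) f (path_of j) i 0.

Lemma path_mxE f s : s \in paths -> path_mx f *m path_vect s = f s.
Proof.
move=> sp; rewrite /path_vect sp -colE; apply/colP => i.
by rewrite !mxE path_indexK.
Qed.

Lemma path_mx_ext (A B : 'M[K]_M) :
  (forall s, s \in paths -> A *m path_vect s = B *m path_vect s) -> A = B.
Proof.
move=> AB; apply/matrixP => i j.
have := AB _ (path_of_mem j); rewrite /path_vect path_of_mem path_ofK -!colE.
by move/colP/(_ i); rewrite !mxE.
Qed.

Definition g_mx (i : nat) : 'M[K]_M := path_mx (fun s =>
  if drop i s is x :: y :: b then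
    diag_coef x y *: path_vect s
    + swap_coef x y *: path_vect (take i s ++ y :: x :: b)
  else 0).

Lemma mem_paths_neq a x y b : a ++ x :: y :: b \in paths -> x != y.
Proof. by rewrite mem_paths => /andP[_ /legal_neq]. Qed.

Lemma mem_paths_neq3 a x y z b : a ++ x :: y :: z :: b \in paths ->
  [/\ x != y, y != z & x != z].
Proof.
move=> p; split; first exact: mem_paths_neq p.
- by move: p; rewrite -cat_rcons; apply: mem_paths_neq.
- by move: p; rewrite mem_paths => /andP[_ /legal_neq2].
Qed.

Lemma mem_paths_swap a x y b : apart x y ->
  (a ++ x :: y :: b \in paths) = (a ++ y :: x :: b \in paths).
Proof.
by move=> xy; rewrite !mem_paths (legal_swap _ _ _ xy) !size_cat.
Qed.

(** When the left-hand sequence is illegal, either the exchanged one is illegal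
    too, or the swap coefficient is zero. *)
Lemma g_mxE a x y b : g_mx (size a) *m path_vect (a ++ x :: y :: b) =
  diag_coef x y *: path_vect (a ++ x :: y :: b)
  + swap_coef x y *: path_vect (a ++ y :: x :: b).
Proof.
have [p|p] := boolP (a ++ x :: y :: b \in paths).
  by rewrite path_mxE // drop_size_cat // take_size_cat.
rewrite {1 2}/path_vect (negbTE p) mulmx0 scaler0 add0r.
rewrite /swap_coef; case: ifP => [xy|_]; last by rewrite scale0r.
by rewrite /path_vect -(mem_paths_swap _ _ xy) (negbTE p) scaler0.
Qed.

Lemma paths_split s i : s \in paths -> (i < n)%N ->
  exists a x b, s = a ++ x :: b /\ size a = i.
Proof.
rewrite mem_paths => /andP[/eqP ss _] i_n.
have si : (i < size s)%N by rewrite ss.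
case E : (drop i s) => [|x b].
  by move/eqP: E; rewrite -size_eq0 size_drop subn_eq0 leqNgt si.
by exists (take i s), x, b; rewrite -E cat_take_drop size_takel // ltnW.
Qed.

Lemma paths_split2 s i : s \in paths -> (i.+1 < n)%N ->
  exists a x y b, s = a ++ x :: y :: b /\ size a = i.
Proof.
move=> sp i_n; have [a [x [b [sE ai]]]] := paths_split sp (ltnW i_n).
case: b sE => [|y b] sE; last by exists a, x, y, b.
by move: sp; rewrite mem_paths sE size_cat ai /= addn1 ltn_eqF.
Qed.

Lemma paths_split3 s i : s \in paths -> (i.+2 < n)%N ->
  exists a x y z b, s = a ++ x :: y :: z :: b /\ size a = i.
Proof.
move=> sp i_n; have [a [x [y [b [sE ai]]]]] := paths_split2 sp (ltnW i_n).
case: b sE => [|z b] sE; last by exists a, x, y, z, b.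
by move: sp; rewrite mem_paths sE size_cat ai /= addn2 ltn_eqF.
Qed.

Lemma g_mxSE a x y z b :
  g_mx (size a).+1 *m path_vect (a ++ x :: y :: z :: b) =
  diag_coef y z *: path_vect (a ++ x :: y :: z :: b)
  + swap_coef y z *: path_vect (a ++ x :: z :: y :: b).
Proof. by have := g_mxE (rcons a x) y z b; rewrite size_rcons !cat_rcons. Qed.

Lemma g_mx_far i j : (i.+1 < j)%N -> (j.+1 < n)%N ->
  g_mx i *m g_mx j = g_mx j *m g_mx i.
Proof.
move=> ij jn; apply: path_mx_ext => s sp; rewrite -!mulmxA.
have [|a [x [y [b [sE ai]]]]] := @paths_split2 s i sp; first lia.
have [c [u [v [e [bE ci]]]]] :
    exists c u v e, b = c ++ u :: v :: e /\ size (a ++ x :: y :: c) = j.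
  have [f [u [v [e [sE' fj]]]]] := paths_split2 sp jn.
  exists (drop i.+2 f), u, v, e.
  have fE : f = a ++ x :: y :: drop i.+2 f.
    rewrite -[LHS](cat_take_drop i.+2) -[X in _ = X](cat_rcons) -cat_rcons.
    congr (_ ++ _).
    have -> : take i.+2 f = take i.+2 s by rewrite sE' takel_cat // fj; lia.
    rewrite sE -!cat_rcons take_size_cat // !size_rcons ai //.
  split; last by rewrite -fE.
  move: sE'; rewrite {1}sE {1}fE -!catA /= => /eqP.
  by rewrite eqseq_cat // eqxx => /= /eqP[].
have catE p r t w : a ++ p :: r :: c ++ t :: w :: e =
    (a ++ p :: r :: c) ++ t :: w :: e by rewrite -catA.
have gj p r t w : g_mx j *m path_vect (a ++ p :: r :: c ++ t :: w :: e) =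
    diag_coef t w *: path_vect (a ++ p :: r :: c ++ t :: w :: e)
    + swap_coef t w *: path_vect (a ++ p :: r :: c ++ w :: t :: e).
  by rewrite !catE -g_mxE; congr (g_mx _ *m _); rewrite -ci !size_cat.
rewrite sE bE -ai gj g_mxE !mulmxDr -!scalemxAr !g_mxE !gj.
move: (path_vect _) (path_vect _) (path_vect _) (path_vect _) => v1 v2 v3 v4.
by apply/colP => k; rewrite !mxE; ring.
Qed.

Hypothesis q_neq0 : q != 0.
Hypothesis q_inj : injective (fun k => q ^+ k).

Lemma g_mx_braid i : (i.+2 < n)%N ->
  g_mx i *m g_mx i.+1 *m g_mx i = g_mx i.+1 *m g_mx i *m g_mx i.+1.
Proof.
move=> i_n; apply: path_mx_ext => s sp; rewrite -!mulmxA.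
have [a [x [y [z [b [sE <-]]]]]] := paths_split3 sp i_n.
move: sp; rewrite {s}sE => /mem_paths_neq3[xy yz xz].
apply: (coef_braid q_neq0 q_inj (v := fun x y z => path_vect (a ++ x :: y :: z :: b)))
  => // x' y' z'; [exact: g_mxE | exact: g_mxSE].
Qed.

Fixpoint jm_mx k : 'M[K]_M :=
  if k is k'.+1 then g_mx k' *m jm_mx k' *m g_mx k' else 1.

(** By induction on the position, from [J_(i+1) = g_i J_i g_i]. *)
Lemma jm_mxE a x b : jm_mx (size a) *m path_vect (a ++ x :: b) =
  content x *: path_vect (a ++ x :: b).
Proof.
have [p|p] := boolP (a ++ x :: b \in paths); last first.
  by rewrite /path_vect (negbTE p) mulmx0 scaler0.
elim/last_ind: a x b p => [|a y IH] x b p.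
  rewrite mul1mx /content (@vacuum_up d n x) ?divff ?scale1r ?expf_neq0 //.
  by move: p; rewrite mem_paths /= => /and3P[].
move: p; rewrite size_rcons cat_rcons => p; rewrite /= -!mulmxA.
have yx := mem_paths_neq p.
rewrite g_mxE mulmxDr -!scalemxAr IH //.
have -> : swap_coef y x *: (jm_mx (size a) *m path_vect (a ++ x :: y :: b)) =
          swap_coef y x *: (content x *: path_vect (a ++ x :: y :: b)).
  have [/eqP-> //|] := boolP (swap_coef y x == 0); first by rewrite !scale0r.
  rewrite (swap_coef_eq0 q_neq0 q_inj yx) negbK => ap.
  by rewrite IH // -(mem_paths_swap _ _ ap).
apply: (coef_content q_neq0 q_inj (v := fun x y => path_vect (a ++ x :: y :: b)))
  => // x' y'; exact: g_mxE.
Qed.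

Variable zeta : K.

Definition t_mx (j : nat) : 'M[K]_M := path_mx (fun s =>
  if drop j s is x :: _ then zeta ^+ x.1 *: path_vect s else 0).

Lemma t_mxE a x b : t_mx (size a) *m path_vect (a ++ x :: b) =
  zeta ^+ x.1 *: path_vect (a ++ x :: b).
Proof.
have [p|p] := boolP (a ++ x :: b \in paths).
  by rewrite path_mxE // drop_size_cat.
by rewrite /path_vect (negbTE p) mulmx0 scaler0.
Qed.

Lemma t_mxSE a x y b : t_mx (size a).+1 *m path_vect (a ++ x :: y :: b) =
  zeta ^+ y.1 *: path_vect (a ++ x :: y :: b).
Proof. by have := t_mxE (rcons a x) y b; rewrite size_rcons !cat_rcons. Qed.

Lemma t_mxX i c (v : 'cV[K]_M) m :
  t_mx i *m v = c *: v -> t_mx i ^+ m *m v = c ^+ m *: v.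
Proof.
move=> tv; elim: m => [|m IH]; first by rewrite expr0 mul1mx scale1r.
by rewrite exprS -mulmxE -mulmxA IH -scalemxAr tv scalerA -exprSr.
Qed.

Lemma t_mx_nth x0 s j : size s = n -> (j < n)%N ->
  t_mx j *m path_vect s = zeta ^+ (nth x0 s j).1 *: path_vect s.
Proof.
move=> ss jn; have js : (j < size s)%N by rewrite ss.
have sE : s = take j s ++ nth x0 s j :: drop j.+1 s.
  by rewrite -drop_nth // cat_take_drop.
by have := t_mxE (take j s) (nth x0 s j) (drop j.+1 s); rewrite -sE size_takel // ltnW.
Qed.

Lemma path_size s : s \in paths -> size s = n.
Proof. by rewrite mem_paths => /andP[/eqP]. Qed.

Lemma t_mxC i j : (i < n)%N -> (j < n)%N -> t_mx i *m t_mx j = t_mx j *m t_mx i.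
Proof.
move=> i_n j_n; apply: path_mx_ext => s sp; rewrite -!mulmxA.
have [_ [x0 _]] := paths_split sp i_n; have ss := path_size sp.
by rewrite !(t_mx_nth x0) // -!scalemxAr !(t_mx_nth x0) // !scalerA mulrC.
Qed.

Lemma t_mx_g_far i j : (i.+1 < n)%N -> (j < n)%N -> j != i -> j != i.+1 ->
  t_mx j *m g_mx i = g_mx i *m t_mx j.
Proof.
move=> i_n j_n ji ji1; apply: path_mx_ext => s sp; rewrite -!mulmxA.
have [a [x [y [b [sE ai]]]]] := paths_split2 sp i_n; have ss := path_size sp.
have ss' : size (a ++ y :: x :: b) = n by move: ss; rewrite sE !size_cat.
have nthE : nth x (a ++ y :: x :: b) j = nth x s j.
  rewrite sE !nth_cat ai; case: ltngtP => // [ij|e]; last by rewrite e eqxx in ji.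
  have : (1 < j - i)%N by clear -ij ji1; lia.
  by case: (j - i)%N => [|[]].
rewrite (t_mx_nth x ss j_n) -scalemxAr sE -ai g_mxE mulmxDr -!scalemxAr.
by rewrite -sE !(t_mx_nth x) // nthE scalerDr !scalerA ![_ * zeta ^+ _]mulrC.
Qed.

Lemma t_mx_gL i : (i.+1 < n)%N -> t_mx i *m g_mx i = g_mx i *m t_mx i.+1.
Proof.
move=> i_n; apply: path_mx_ext => s sp; rewrite -!mulmxA.
have [a [x [y [b [sE <-]]]]] := paths_split2 sp i_n.
rewrite sE t_mxSE -scalemxAr g_mxE mulmxDr -!scalemxAr !t_mxE scalerDr.
rewrite !scalerA [_ * zeta ^+ y.1]mulrC; congr (_ *: _ + _).
rewrite /diag_coef; case: eqP => [->|]; first exact: mulrC.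
by rewrite mulr0 mul0r.
Qed.

Lemma t_mx_gR i : (i.+1 < n)%N -> t_mx i.+1 *m g_mx i = g_mx i *m t_mx i.
Proof.
move=> i_n; apply: path_mx_ext => s sp; rewrite -!mulmxA.
have [a [x [y [b [sE <-]]]]] := paths_split2 sp i_n.
rewrite sE t_mxE -scalemxAr g_mxE mulmxDr -!scalemxAr !t_mxSE scalerDr.
rewrite !scalerA [_ * zeta ^+ x.1]mulrC; congr (_ *: _ + _).
rewrite /diag_coef; case: eqP => [->|]; first exact: mulrC.
by rewrite mulr0 mul0r.
Qed.

Hypothesis zeta_prim : d.-primitive_root zeta.

Definition e_mx i : 'M[K]_M :=
  d%:R^-1 *: \sum_(0 <= s < d) t_mx i ^+ s *m t_mx i.+1 ^+ (d - s).

(** The sum of the first [d] powers of a [d]-th root of unity other than 1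
    vanishes; here the root is [zeta] to the difference of the two colours. *)
Lemma e_mxE a x y b :
  e_mx (size a) *m path_vect (a ++ x :: y :: b) =
  (x.1 == y.1)%:R *: path_vect (a ++ x :: y :: b).
Proof.
set v := path_vect _; rewrite /e_mx -scalemxAl mulmx_suml.
have zd : zeta ^+ d = 1 := prim_expr_order zeta_prim.
have z_neq0 : zeta != 0.
  by apply/eqP => z0; move/eqP: zd; rewrite z0 expr0n gtn_eqF // eq_sym oner_eq0.
pose w := zeta ^+ x.1 / zeta ^+ y.1.
have wd : w ^+ d = 1.
  by rewrite expr_div_n -!exprM !(mulnC _ d) !exprM zd !expr1n divr1.
have d_neq0 : d%:R != 0 :> K := prim_root_natf_neq0 zeta_prim.
have -> : \sum_(0 <= s < d) (t_mx (size a) ^+ s *m t_mx (size a).+1 ^+ (d - s)) *m v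
        = (\sum_(s < d) w ^+ s) *: v.
  rewrite scaler_suml big_mkord; apply: eq_bigr => s _.
  rewrite -mulmxA (t_mxX _ (t_mxSE a x y b)) -scalemxAr.
  rewrite (t_mxX _ (t_mxE a x (y :: b))) scalerA; congr (_ *: _).
  rewrite mulrC /w expr_div_n; congr (_ * _).
  apply: (mulIf (expf_neq0 s (expf_neq0 y.1 z_neq0))).
  rewrite mulVf ?expf_neq0 // -exprD subnK 1?ltnW //.
  by rewrite -exprM mulnC exprM zd expr1n.
have [c|c] := eqVneq x.1 y.1; last first.
  have w1 : w != 1.
    apply: contra_neq c => w1; apply: val_inj.
    have /eqP := divr1_eq w1; rewrite (eq_prim_root_expr zeta_prim).
    by rewrite !modn_small // => /eqP.
  have := subrX1 w d; rewrite wd subrr => /esym/eqP.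
  by rewrite mulf_eq0 subr_eq0 (negbTE w1) => /eqP ->; rewrite !scale0r scaler0.
have -> : w = 1 by rewrite /w c divff ?expf_neq0.
under eq_bigr do rewrite expr1n.
by rewrite sumr_const card_ord scalerA mulVf.
Qed.

Lemma t_mxXd j : (j < n)%N -> t_mx j ^+ d = 1.
Proof.
move=> j_n; apply: path_mx_ext => s sp.
have [a [x [b [sE <-]]]] := paths_split sp j_n.
rewrite sE (t_mxX _ (t_mxE a x b)) -exprM mulnC exprM.
by rewrite (prim_expr_order zeta_prim) expr1n scale1r mul1mx.
Qed.

Lemma g_mx_quadratic i : (i.+1 < n)%N ->
  g_mx i *m g_mx i = 1 + (q - q^-1) *: (e_mx i *m g_mx i).
Proof.
move=> i_n; apply: path_mx_ext => s sp.
have [a [x [y [b [sE <-]]]]] := paths_split2 sp i_n.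
have xy : x != y by apply: (@mem_paths_neq a x y b); rewrite -sE.
rewrite sE mulmxDl mul1mx -scalemxAl -!mulmxA.
rewrite (coef_quadratic q_neq0 q_inj (v := fun x y => path_vect (a ++ x :: y :: b)))
  => [|x' y'|//]; last exact: g_mxE.
congr (_ + _ *: _); rewrite g_mxE mulmxDr -!scalemxAr !e_mxE [y.1 == _]eq_sym.
by rewrite scalerDr !scalerA ![_%:R * _]mulrC.
Qed.

End Representation.

(** * Matrix units in the image *)

Section Subalgebra.
Local Open Scope ring_scope.
Variables (K : comNzRingType) (B : algType K).

(** The same closure properties as in [is_subalgebra], on plain predicates rather
    than through boolean membership. *)
Definition subalgebra (P : B -> Prop) :=
  [/\ P 1, forall k x y, P x -> P y -> P (k *: x + y)
    & forall x y, P x -> P y -> P (x * y)].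

Variable P : B -> Prop.
Hypothesis P_alg : subalgebra P.

Lemma subalgebra0 : P 0.
Proof. by have [P1 PD _] := P_alg; rewrite -(addNr 1) -scaleN1r; apply: PD. Qed.

Lemma subalgebraD x y : P x -> P y -> P (x + y).
Proof. by have [_ PD _] := P_alg; move=> Px; rewrite -(scale1r x); apply: PD. Qed.

Lemma subalgebraZ k x : P x -> P (k *: x).
Proof.
have [_ PD _] := P_alg; move=> Px; rewrite -[_ *: _]addr0.
exact: PD subalgebra0.
Qed.

Lemma subalgebra_sum (I : Type) (r : seq I) (F : I -> B) :
  (forall i, P (F i)) -> P (\sum_(i <- r) F i).
Proof.
move=> PF; elim/big_rec: _ => [|i x _]; first exact: subalgebra0.
exact/subalgebraD/PF.
Qed.

End Subalgebra.

Lemma delta_mul_delta (K : comNzRingType) m (A : 'M[K]_m) i j :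
  (delta_mx i i *m A *m delta_mx j j = A i j *: delta_mx i j)%R.
Proof.
rewrite -(mul_delta_mx (ord0 : 'I_1) i i) -(mul_delta_mx (ord0 : 'I_1) j j).
rewrite -!mulmxA (mulmxA A) -colE (mulmxA (delta_mx ord0 i)) -rowE.
rewrite [row i _]mx11_scalar !mxE mul_scalar_mx -scalemxAr.
by rewrite mul_delta_mx.
Qed.

Section MatrixUnits.
Local Open Scope ring_scope.
Variables (K : fieldType) (d n : nat) (q zeta : K).
Hypothesis d_gt0 : (0 < d)%N.
Hypothesis q_neq0 : q != 0.
Hypothesis q_inj : injective (fun k => q ^+ k).
Hypothesis zeta_prim : d.-primitive_root zeta.
Local Notation hop := (hop d n).
Local Notation paths := (paths d n).
Local Notation M := (size paths).-1.+1.
Local Notation g_mx := (@g_mx K d n q).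
Local Notation t_mx := (@t_mx K d n zeta).
Local Notation jm_mx := (@jm_mx K d n q).
Local Notation content := (@content K d n q).
Local Notation path_vect := (@path_vect K d n).
Implicit Types (x y : hop) (s : seq hop) (i : 'I_M).

Variable P : 'M[K]_M -> Prop.
Hypothesis P_alg : subalgebra P.
Hypothesis P_t : forall j, (j < n)%N -> P (t_mx j).
Hypothesis P_jm : forall j, (j < n)%N -> P (jm_mx j).

Lemma path_vect_of i : path_vect (path_of i) = delta_mx i 0.
Proof. by rewrite /path_vect path_of_mem // path_ofK. Qed.

Lemma diag_path_mx (A : 'M[K]_M) (f : seq hop -> K) :
  (forall s, s \in paths -> A *m path_vect s = f s *: path_vect s) ->
  A = diag_mx (\row_i f (path_of i)).
Proof.
move=> Af; apply/matrixP => i k.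
have := Af _ (path_of_mem d_gt0 k); rewrite path_vect_of -colE.
move/colP/(_ i); rewrite !mxE => ->.
by rewrite eqxx andbT; case: eqP => [->|_]; rewrite ?mulr1n ?mulr1 ?mulr0n ?mulr0.
Qed.

Lemma jm_mx_nth x0 s j : size s = n -> (j < n)%N ->
  jm_mx j *m path_vect s = content (nth x0 s j) *: path_vect s.
Proof.
move=> ss jn; have js : (j < size s)%N by rewrite ss.
have sE : s = take j s ++ nth x0 s j :: drop j.+1 s.
  by rewrite -drop_nth // cat_take_drop.
have := jm_mxE d_gt0 q_neq0 q_inj (take j s) (nth x0 s j) (drop j.+1 s).
by rewrite -sE size_takel // ltnW.
Qed.

(** Two different paths differ at some position in their colours, where an
    element [t_j] separates them, or in their diagonals, where some [J_j] does. *)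
Lemma separate_paths i i' : i != i' ->
  exists c : 'rV[K]_M, P (diag_mx c) /\ c 0 i != c 0 i'.
Proof.
move=> ii'; pose x0 : hop := (Ordinal d_gt0, ord0).
have si k : size (path_of k) = n := path_size (path_of_mem d_gt0 k).
have [j jn sj] : exists2 j, (j < n)%N & nth x0 (path_of i) j != nth x0 (path_of i') j.
  have [/existsP[j sj]|/existsPn no_j] :=
    boolP [exists j : 'I_n, nth x0 (path_of i) j != nth x0 (path_of i') j].
    by exists j.
  case/eqP: ii'; apply: (can_inj (path_ofK d_gt0)).
  apply: (@eq_from_nth _ x0); rewrite !si // => j jn.
  by apply/eqP; have := no_j (Ordinal jn); rewrite negbK.
have [c|c] := eqVneq (nth x0 (path_of i) j).1 (nth x0 (path_of i') j).1.
  exists (\row_k content (nth x0 (path_of k) j)); split.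
    rewrite -(@diag_path_mx (jm_mx j) (fun s => content (nth x0 s j))).
      exact: P_jm.
    by move=> s sp; apply: jm_mx_nth (path_size sp) jn.
  by rewrite !mxE content_eq // (hop_neq sj).
exists (\row_k zeta ^+ (nth x0 (path_of k) j).1); split.
  rewrite -(@diag_path_mx (t_mx j) (fun s => zeta ^+ (nth x0 s j).1)).
    exact: P_t.
  by move=> s sp; apply: t_mx_nth (path_size sp) jn.
rewrite !mxE (eq_prim_root_expr zeta_prim) !modn_small //.
Qed.

(** Lagrange interpolation on the joint spectrum: the idempotent is a product,
    over the other paths, of combinations of the identity and of a separating
    diagonal matrix. *)
Lemma path_idempotent i : P (delta_mx i i).
Proof.
have [P1 PD PM] := P_alg.
have sep i' : i' != i ->
    exists c : 'rV[K]_M, [/\ P (diag_mx c), c 0 i = 1 & c 0 i' = 0].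
  rewrite eq_sym => /separate_paths[c [Pc ci]].
  exists ((c 0 i - c 0 i')^-1 *: (- c 0 i' *: const_mx 1 + c)); split.
  - rewrite linearZ linearD linearZ /= diag_const_mx.
    by apply: (subalgebraZ P_alg); apply: PD.
  - by rewrite !mxE mulr1 [- _ + _]addrC mulVf // subr_eq0.
  - by rewrite !mxE mulr1 addNr mulr0.
suff [c [Pc ci c0]] : exists c : 'rV[K]_M,
    [/\ P (diag_mx c), c 0 i = 1 & forall i', i' \in enum (predC1 i) -> c 0 i' = 0].
  have -> : delta_mx i i = diag_mx c; last exact: Pc.
  apply/matrixP => k l; rewrite !mxE; case: (k =P i) => [->|/eqP ki] /=.
    by case: (l =P i) => [->|/eqP li]; rewrite ?eqxx ?ci // eq_sym (negbTE li).
  by rewrite c0 ?mul0rn // mem_enum inE.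
have: {subset enum (predC1 i) <= predC1 i} by move=> k; rewrite mem_enum.
elim: (enum _) => [_|k r IH kr].
  exists (const_mx 1); split=> //; first by rewrite diag_const_mx.
  by rewrite mxE.
have [|c [Pc ci c0]] := IH; first by move=> l lr; apply: kr; rewrite inE lr orbT.
have [|e [Pe ei ek]] := sep k; first exact: (kr _ (mem_head _ _)).
exists (\row_l (e 0 l * c 0 l)); split.
- have -> : diag_mx (\row_l (e 0 l * c 0 l)) = diag_mx e * diag_mx c.
    by rewrite -mulmxE mulmx_diag.
  exact: PM.
- by rewrite mxE ei ci mulr1.
- move=> l; rewrite inE mxE => /orP[/eqP->|/c0 ->]; last by rewrite mulr0.
  by rewrite ek mul0r.
Qed.

Hypothesis P_g : forall j, (j.+1 < n)%N -> P (g_mx j).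

Local Notation index := (@path_index d n).

(** Along a chain of exchanges, each step multiplies by [E_TT g_i E_SS], which is
    a nonzero multiple of [E_TS]. *)
Lemma path_matrix_unit s s' : s \in paths -> s' \in paths ->
  final (vacuum d n) s = final (vacuum d n) s' ->
  P (delta_mx (index s') (index s)).
Proof.
have [P1 PD PM] := P_alg.
move=> sp sp' ss'; have : linked s s'.
  move: (sp) (sp'); rewrite !mem_paths => /andP[/eqP a la] /andP[/eqP b lb].
  by apply: (@legal_linked d n (vacuum d n)) => //; [apply: vacuum_down | rewrite a b].
move=> lk; elim: lk sp sp' {ss'} => {s s'} [s _ _|a x y b c xy _ IH sp sp'].
  exact: path_idempotent.
have sp1 : a ++ y :: x :: b \in paths by rewrite -(mem_paths_swap _ _ xy).
have {}IH := IH sp1 sp'.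
have an : ((size a).+1 < n)%N.
  by have := path_size sp; rewrite size_cat /=; lia.
have xny := mem_paths_neq sp.
set s := a ++ _ in sp *; set s1 := a ++ _ in sp1 IH.
have ss1 : s1 != s.
  apply/eqP => /eqP; rewrite eqseq_cat // eqxx /= => /eqP[yx _].
  by rewrite yx eqxx in xny.
have gE : g_mx (size a) (index s1) (index s) = swap_coef q x y.
  have := g_mxE q d_gt0 a x y b; rewrite -/s -/s1 {1}/path_vect sp -colE.
  move/colP/(_ (index s1)); rewrite !mxE => ->; rewrite /path_vect sp sp1 !mxE.
  rewrite !eqxx mulr1 (inj_in_eq (can_in_inj (path_indexK d_gt0))) //.
  by rewrite (negbTE ss1) mulr0 add0r.
have b0 : swap_coef q x y != 0 by rewrite swap_coef_eq0 // negbK.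
have -> : delta_mx (index c) (index s) =
    (swap_coef q x y)^-1 *: (delta_mx (index c) (index s1) *
     (delta_mx (index s1) (index s1) * g_mx (size a) * delta_mx (index s) (index s))).
  rewrite -!mulmxE delta_mul_delta gE -scalemxAr mul_delta_mx scalerA.
  by rewrite mulVf // scale1r.
apply/(subalgebraZ P_alg)/(PM _ _ IH)/PM; last exact: path_idempotent.
by apply: PM; [exact: path_idempotent|exact: P_g].
Qed.

End MatrixUnits.

(** * Evaluating the presented algebra *)

Section Presentation.
Local Open Scope ring_scope.
Local Open Scope quotient_scope.
Variables (F : fieldType) (d n : nat).
Local Notation L := (laurent_ring F).
Local Notation K := {fraction {poly F}}.
Local Notation FA := (free_alg L (yh_gen n)).
Local Notation A := (ratyh F d n).
Local Notation incl := (@laurent_incl F).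
Local Notation pi := (quot_pi (yh_ideal F d n)).

Definition of_free (x : FA) : A := pure incl 1 (pi x).

Lemma of_freeD x y : of_free (x + y) = of_free x + of_free y.
Proof.
rewrite /of_free quot_piD -[RHS]/(tensor_add _ _) tensor_piD.
by apply/tensor_piP; apply: tensor_addr.
Qed.

Lemma of_freeZ c x : of_free (c *: x) = incl c *: of_free x.
Proof.
rewrite /of_free quot_piZ -[RHS]/(tensor_scale _ _) tensor_piZ.
apply/tensor_piP/tensor_sym; rewrite /= mulr1 -[incl c]mul1r.
exact: tensor_balance.
Qed.

Lemma of_freeM x y : of_free (x * y) = of_free x * of_free y.
Proof.
by rewrite /of_free quot_piM -[RHS]/(tensor_mul _ _) tensor_piM /= mulr1.
Qed.

Lemma of_free1 : of_free 1 = 1.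
Proof. exact: (erefl (pure incl 1 (pi 1))). Qed.

Lemma of_free0 : of_free 0 = 0.
Proof. by apply: (addrI (of_free 0)); rewrite -of_freeD !addr0. Qed.

Lemma of_freeB x y : of_free (x - y) = of_free x - of_free y.
Proof. by rewrite of_freeD -scaleN1r of_freeZ rmorphN1 scaleN1r. Qed.

Lemma of_freeX x k : of_free (x ^+ k) = of_free x ^+ k.
Proof. by elim: k => [|k IH]; rewrite ?of_free1 // !exprS of_freeM IH. Qed.

Lemma of_free_relator (x : FA) : yh_relator d x -> of_free x = 0.
Proof.
move=> rx; rewrite -of_free0 /of_free; congr pure; apply/quot_piP.
by rewrite subr0 => I [_ sI]; apply: sI.
Qed.

Definition gen_g i : A := of_free (free_g F i).
Definition gen_t j : A := of_free (free_t F j).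

(** Every element is a combination of words in the generators, which are built
    from 1 by multiplications on the right. *)
Lemma ratyh_ind (S : A -> Prop) :
  S 1 -> (forall k x y, S x -> S y -> S (k *: x + y)) ->
  (forall i x, S x -> S (x * gen_g i)) -> (forall j x, S x -> S (x * gen_t j)) ->
  forall x, S x.
Proof.
move=> S1 SD Sg St.
have S0 : S 0 by rewrite -(addNr 1) -scaleN1r; apply: SD.
have SA x y : S x -> S y -> S (x + y) by move=> Sx; rewrite -(scale1r x); apply: SD.
have SZ k x : S x -> S (k *: x) by move=> Sx; rewrite -(addr0 (k *: x)); apply: SD.
have Sfree (x : FA) : S (of_free x).
  rewrite [x]monalgE; elim/big_rec: _ => [|m y _ Sy]; first by rewrite of_free0.
  rewrite of_freeD; apply: SA => //.
  have -> : << x@_m *g m >> = x@_m *: (<< m >> : FA).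
    by apply/malgP => k; rewrite mcoeffZ !mcoeffU mulrnAr mulr1.
  rewrite of_freeZ; apply: SZ.
  case: m => m; elim/last_ind: m => [|m v IH].
    have -> : << FMonom [::] >> = 1 :> FA; last by rewrite of_free1.
    by rewrite -[FMonom [::]]fmE.
  have -> : << FMonom (rcons m v) >> = (<< FMonom m >> : FA) * free_gen L v.
    rewrite free_malgM /free_gen malgM_def fgmulUU mulr1; congr (<< _ *g _ >>).
    by rewrite /mmul /= /fmmul /fmu !fmE /= cats1.
  by rewrite of_freeM; case: v => [i|j]; [apply: Sg|apply: St].
move=> x; rewrite -[x]tensor_piE; elim: (repr x) => [|[k y] s IH]; first exact: S0.
have -> : tensor_pi incl ((k, y) :: s) = k *: of_free (repr y) + tensor_pi incl s.
  rewrite -[RHS]/(tensor_add (tensor_scale _ _) _) tensor_piZ tensor_piD.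
  by rewrite /= mulr1 quot_piE.
exact: SD.
Qed.

Section Evaluation.
Variables (B : algType K) (gB : 'I_n.-1 -> B) (tB : 'I_n -> B).

Definition gen_val (v : yh_gen n) : B :=
  match v with inl i => gB i | inr j => tB j end.

Definition word_val (m : {fmonom yh_gen n}) : B := \prod_(v <- (m : seq _)) gen_val v.

Lemma word_val_morph : mmorphism word_val.
Proof.
split=> [x y|]; rewrite /word_val.
  by rewrite /mmul /= /fmmul fmE /= big_cat.
by rewrite /mone /= /fmone fmE /= big_nil.
Qed.

HB.instance Definition _ :=
  isMultiplicative.Build {fmonom yh_gen n} B word_val word_val_morph.

Definition scalar_val : L -> B := in_alg B \o incl.
HB.instance Definition _ := GRing.RMorphism.on scalar_val.

Definition free_val (x : FA) : B := mmap scalar_val word_val x.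

Lemma free_valD x y : free_val (x + y) = free_val x + free_val y.
Proof. exact: mmapD. Qed.

Lemma free_valB x y : free_val (x - y) = free_val x - free_val y.
Proof. exact: mmapB. Qed.

Lemma free_val0 : free_val 0 = 0.
Proof. exact: mmap0. Qed.

Lemma free_val1 : free_val 1 = 1.
Proof. exact: mmap1. Qed.

Lemma free_valZ c x : free_val (c *: x) = incl c *: free_val x.
Proof.
pose u : {malg L[{fmonom yh_gen n}]} := x.
have E : mmap scalar_val word_val (c *: u) = scalar_val c * mmap scalar_val word_val u.
  exact: mmapZ.
have E2 : scalar_val c * mmap scalar_val word_val u = incl c *: free_val x.
  by rewrite /scalar_val /= mulr_algl.
rewrite -E2 -E. reflexivity.
Qed.

Lemma free_valM x y : free_val (x * y) = free_val x * free_val y.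
Proof.
rewrite free_malgM; apply: (commr_mmap_is_multiplicative _).1 => u m m'.
by rewrite /GRing.comm /scalar_val /= mulr_algl mulr_algr.
Qed.

Lemma free_valX x k : free_val (x ^+ k) = free_val x ^+ k.
Proof. by elim: k => [|k IH]; rewrite ?free_val1 // !exprS free_valM IH. Qed.

Lemma free_val_gen v : free_val (free_gen L v) = gen_val v.
Proof.
rewrite /free_val /free_gen mmapU /= rmorph1 mul1r /word_val /fmu fmE /=.
by rewrite big_seq1.
Qed.

Hypothesis free_val_relator : forall x : FA, yh_relator d x -> free_val x = 0.

Lemma free_val_ideal x : ideal_gen (@yh_relator F d n) x -> free_val x = 0.
Proof.
apply: (smallest_sub (X := [set x | free_val x = 0]%classic)).
- split=> [|u v /= u0 v0|a u b /= u0]; first exact: free_val0.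
  + by rewrite free_valB u0 v0 subr0.
  + by rewrite !free_valM u0 mulr0 mul0r.
- exact: free_val_relator.
Qed.

Definition yh_val (y : yh F d n) : B := free_val (repr y).

Lemma yh_val_pi x : yh_val (pi x) = free_val x.
Proof.
apply/eqP; rewrite -subr_eq0 -free_valB; apply/eqP/free_val_ideal.
by apply: (quot_piP (yh_ideal F d n) _ _).1; rewrite quot_piE.
Qed.

Lemma yh_valD x y : yh_val (x + y) = yh_val x + yh_val y.
Proof. by rewrite -[x]quot_piE -[y]quot_piE -quot_piD !yh_val_pi free_valD. Qed.

Lemma yh_valM x y : yh_val (x * y) = yh_val x * yh_val y.
Proof.
rewrite -[x]quot_piE -[y]quot_piE -[X in yh_val X = _]/(quot_mul _ _).
by rewrite -quot_piM !yh_val_pi free_valM.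
Qed.

Lemma yh_valZ c x : yh_val (c *: x) = incl c *: yh_val x.
Proof.
rewrite -[x]quot_piE -[X in yh_val X = _]/(quot_scale _ _).
by rewrite -quot_piZ !yh_val_pi free_valZ.
Qed.

Lemma yh_val0 : yh_val 0 = 0.
Proof. by apply: (addrI (yh_val 0)); rewrite -yh_valD !addr0. Qed.

Lemma yh_val1 : yh_val 1 = 1.
Proof. exact: etrans (yh_val_pi 1) free_val1. Qed.

Definition formal_val (s : seq (K * yh F d n)) : B :=
  \sum_(p <- s) p.1 *: yh_val p.2.

Lemma formal_val_eq s t : tensor_eq incl s t -> formal_val s = formal_val t.
Proof.
rewrite /formal_val; elim=> {s t} //=.
- by move=> s t u _ -> _ ->.
- by move=> s s' t t' _ h _ h'; rewrite !big_cat /= h h'.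
- by move=> s t; rewrite !big_cat /= addrC.
- by move=> k k' y; rewrite !big_cons big_nil !addr0 scalerDl.
- by move=> k y y'; rewrite !big_cons big_nil !addr0 yh_valD scalerDr.
- by move=> y; rewrite big_seq1 big_nil scale0r.
- by move=> k; rewrite big_seq1 big_nil yh_val0 scaler0.
- by move=> k r y; rewrite !big_seq1 /= yh_valZ scalerA.
Qed.

(** The universal property of the presentation, extended in turn from the free
    algebra to its quotient and to the tensor product. *)
Definition ratyh_val (x : A) : B := formal_val (repr x).

Lemma ratyh_val_pi s : ratyh_val (tensor_pi incl s) = formal_val s.
Proof. by apply/formal_val_eq/tensor_sym/tensor_reprP. Qed.

Lemma ratyh_val_of_free x : ratyh_val (of_free x) = free_val x.
Proof. by rewrite ratyh_val_pi /formal_val big_seq1 scale1r yh_val_pi. Qed.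

Lemma ratyh_valD x y : ratyh_val (x + y) = ratyh_val x + ratyh_val y.
Proof.
rewrite -[x]tensor_piE -[y]tensor_piE -[X in ratyh_val X = _]/(tensor_add _ _).
by rewrite tensor_piD !ratyh_val_pi /formal_val big_cat.
Qed.

Lemma ratyh_valZ k x : ratyh_val (k *: x) = k *: ratyh_val x.
Proof.
rewrite -[x]tensor_piE -[X in ratyh_val X = _]/(tensor_scale _ _).
rewrite tensor_piZ !ratyh_val_pi /formal_val big_map scaler_sumr.
by apply: eq_bigr => p _; rewrite scalerA.
Qed.

Lemma ratyh_valM x y : ratyh_val (x * y) = ratyh_val x * ratyh_val y.
Proof.
rewrite -[x]tensor_piE -[y]tensor_piE -[X in ratyh_val X = _]/(tensor_mul _ _).
rewrite tensor_piM !ratyh_val_pi /formal_val big_allpairs_dep mulr_suml.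
apply: eq_bigr => p _; rewrite mulr_sumr; apply: eq_bigr => r _.
by rewrite yh_valM -scalerAl -scalerAr scalerA.
Qed.

Lemma ratyh_val1 : ratyh_val 1 = 1.
Proof. exact: etrans (ratyh_val_of_free 1) free_val1. Qed.

Lemma ratyh_val_g i : ratyh_val (gen_g i) = gB i.
Proof. by rewrite ratyh_val_of_free free_val_gen. Qed.

Lemma ratyh_val_t j : ratyh_val (gen_t j) = tB j.
Proof. by rewrite ratyh_val_of_free free_val_gen. Qed.

End Evaluation.
End Presentation.

(** * Faithfulness *)

Section Faithful.
Local Open Scope ring_scope.

(** The matrix of [f] on the spanning family is square and has full row space, so
    its rows are independent. *)
Lemma in_span_faithful (K : fieldType) (A : algType K) (s : seq A) p
    (f : A -> 'rV[K]_p) :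
  (forall k x y, f (k *: x + y) = k *: f x + f y) ->
  (forall x, in_span s x) -> (forall k, exists x, f x = delta_mx 0 k) ->
  size s = p -> forall x, f x = 0 -> x = 0.
Proof.
move=> fD s_all f_onto sp.
have f0 : f 0 = 0.
  by have := fD (-1) 0 0; rewrite scaler0 addr0 scaleN1r addNr.
pose B : 'M[K]_(size s, p) := \matrix_(i < size s) f s`_i.
have fE c : f (\sum_(i < size s) c i *: s`_i) = (\row_(i < size s) c i) *m B.
  rewrite mulmx_sum_row; elim/big_rec2: _ => [//|i y x _ <-].
  by rewrite fD mxE rowK.
have : row_full B.
  rewrite -sub1mx; apply/row_subP => k; rewrite row1.
  have [x <-] := f_onto k; have [c ->] := s_all x.
  by rewrite fE submxMl.
rewrite /row_full => /eqP rB x; have [c ->] := s_all x; rewrite fE => c0.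
have : row_free B by rewrite /row_free rB sp.
move/row_free_inj/(_ (\row_(i < size s) c i) 0); rewrite c0 mul0mx => /(_ erefl).
move=> /rowP cz; apply: big1 => i _.
by have := cz i; rewrite !mxE => ->; rewrite scale0r.
Qed.

End Faithful.

Section SeminormalForm.
Local Open Scope ring_scope.
Variables (F : fieldType) (d n : nat) (zeta0 : F).
Hypothesis d_gt0 : (0 < d)%N.
Hypothesis zeta0_prim : d.-primitive_root zeta0.

Local Notation L := (laurent_ring F).
Local Notation K := {fraction {poly F}}.
Local Notation A := (ratyh F d n).
Local Notation q := (FracField.tofrac ('X : {poly F}) : K).

Definition frac_const (c : F) : K := FracField.tofrac c%:P.
HB.instance Definition _ := GRing.RMorphism.copy frac_const
  (@FracField.tofrac {poly F} \o polyC).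

Local Notation zeta := (frac_const zeta0).

Lemma zeta_prim : d.-primitive_root zeta.
Proof. by rewrite fmorph_primitive_root. Qed.

(** This is how the genericity of [q] enters: it is not a root of unity. *)
Lemma fracX_inj : injective (fun k => q ^+ k).
Proof.
move=> k l /=; rewrite -!tofracXn => /eqP; rewrite tofrac_eq => /eqP.
by move/(congr1 (fun p : {poly F} => size p)); rewrite !size_polyXn => -[].
Qed.

Let qX := fracX_neq0 F.

Local Notation M := (size (paths d n)).-1.+1.
Local Notation gM := (fun i : 'I_n.-1 => g_mx d n q i).
Local Notation tM := (fun j : 'I_n => t_mx d n zeta j).
Local Notation fv := (@free_val F n 'M[K]_M gM tM).

Lemma free_val_sum (I : Type) (r : seq I) f :
  fv (\sum_(i <- r) f i) = \sum_(i <- r) fv (f i).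
Proof. by apply: (big_morph _ (@free_valD _ _ _ _ _)); apply: free_val0. Qed.

Lemma ord_ltn (i : 'I_n.-1) : (i.+1 < n)%N.
Proof. exact: ord_hi_subproof. Qed.

Lemma seminormal_relator (x : free_alg L (yh_gen n)) :
  @yh_relator F d n x -> fv x = 0.
Proof.
have vg i : fv (free_g F i) = g_mx d n q i by rewrite free_val_gen.
have vt j : fv (free_t F j) = t_mx d n zeta j by rewrite free_val_gen.
case=> {x} [i j ij|i j ij|i j|i j|j|i]; rewrite free_valB;
  apply/eqP; rewrite subr_eq0; apply/eqP.
- rewrite !free_valM !vg -!mulmxE; case/orP: ij => ij.
    by apply: g_mx_far => //; apply: ord_ltn.
  by symmetry; apply: g_mx_far => //; apply: ord_ltn.
- rewrite !free_valM !vg -!mulmxE ij; apply: (g_mx_braid d_gt0 qX fracX_inj).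
  by rewrite -ij; apply: ord_ltn.
- by rewrite !free_valM !vt -!mulmxE; apply: t_mxC.
- rewrite !free_valM !vt vg -!mulmxE; case: tpermP => [->|->|/eqP ji /eqP ji1].
  + by apply: t_mx_gL => //; apply: ord_ltn.
  + by apply: t_mx_gR => //; apply: ord_ltn.
  + by apply: t_mx_g_far => //; apply: ord_ltn.
- by rewrite free_valX vt free_val1 t_mxXd // zeta_prim.
- rewrite free_valD free_valZ free_valM free_val1 free_valX !vg.
  rewrite expr2 -!mulmxE (g_mx_quadratic d_gt0 qX fracX_inj zeta_prim) ?ord_ltn //.
  congr (_ + _ *: (_ *m _)); rewrite free_valZ free_val_sum; congr (_ *: _).
    by rewrite -[RHS]/(frac_const d%:R^-1) fmorphV rmorph_nat.
  by apply: eq_bigr => s _; rewrite free_valM !free_valX !vt.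
Qed.

Definition seminormal (x : A) : 'M[K]_M := ratyh_val gM tM x.

Lemma seminormalD x y : seminormal (x + y) = seminormal x + seminormal y.
Proof. exact: ratyh_valD seminormal_relator x y. Qed.

Lemma seminormalZ k x : seminormal (k *: x) = k *: seminormal x.
Proof. exact: ratyh_valZ seminormal_relator k x. Qed.

Lemma seminormalM x y : seminormal (x * y) = seminormal x *m seminormal y.
Proof. exact: ratyh_valM seminormal_relator x y. Qed.

Lemma seminormal1 : seminormal 1 = 1.
Proof. exact: ratyh_val1 seminormal_relator. Qed.

Lemma seminormal_g i : seminormal (gen_g F d i) = g_mx d n q i.
Proof. exact: (ratyh_val_g seminormal_relator). Qed.

Lemma seminormal_t j : seminormal (gen_t F d j) = t_mx d n zeta j.
Proof. exact: (ratyh_val_t seminormal_relator). Qed.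

Lemma seminormal_J j : (j < n)%N ->
  seminormal (pure (@laurent_incl F) 1 (yh_J F d n j)) = jm_mx d n q j.
Proof.
move=> jn; rewrite /seminormal (ratyh_val_pi seminormal_relator) /formal_val.
rewrite big_seq1 scale1r /=.
elim: j jn => [|j IH] jn; first exact: (yh_val1 seminormal_relator).
have jn' : (j < n.-1)%N by rewrite ltn_predRL.
rewrite /= insubT /= !(yh_valM seminormal_relator) IH ?(ltnW jn) //.
by rewrite !(yh_val_pi seminormal_relator) free_val_gen.
Qed.

Lemma seminormal_subalgebra (P : A -> Prop) : subalgebra P ->
  subalgebra (fun m => exists2 x, P x & seminormal x = m).
Proof.
move=> [P1 PD PM]; split.
- by exists 1 => //; apply: seminormal1.
- move=> k u v [x Px <-] [y Py <-]; exists (k *: x + y); first exact: PD.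
  by rewrite seminormalD seminormalZ.
- move=> u v [x Px <-] [y Py <-]; exists (x * y); first exact: PM.
  by rewrite seminormalM.
Qed.

(** The normal forms need generators indexed by natural numbers; the values
    outside the range are dummies. *)
Definition ext_g k : A := if insub k is Some i then gen_g F d i else 0.
Definition ext_t k : A := if insub k is Some j then gen_t F d j else 0.

Lemma ext_gE (i : 'I_n.-1) : ext_g i = gen_g F d i.
Proof. by rewrite /ext_g valK. Qed.

Lemma ext_tE (j : 'I_n) : ext_t j = gen_t F d j.
Proof. by rewrite /ext_t valK. Qed.

Lemma relator_eq (x y : free_alg L (yh_gen n)) :
  @yh_relator F d n (x - y) -> of_free d x = of_free d y.
Proof.
by move/of_free_relator/eqP; rewrite of_freeB subr_eq0 => /eqP.
Qed.

Lemma of_free_sum (I : Type) (r : seq I) (f : I -> free_alg L (yh_gen n)) :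
  of_free d (\sum_(i <- r) f i) = \sum_(i <- r) of_free d (f i).
Proof. by apply: (big_morph _ (@of_freeD _ _ _)); apply: of_free0. Qed.

Lemma ratyh_span x : in_span (normal_forms d ext_g ext_t n) x.
Proof.
have gi k (kn : (k.+1 < n)%N) : exists2 i : 'I_n.-1, k = i & ext_g k = gen_g F d i.
  have kn' : (k < n.-1)%N by rewrite ltn_predRL.
  by exists (Ordinal kn'); rewrite // -ext_gE.
have ti k (kn : (k < n)%N) : exists2 j : 'I_n, k = j & ext_t k = gen_t F d j.
  by exists (Ordinal kn); rewrite // -ext_tE.
have tg (i : 'I_n.-1) (j : 'I_n) : gen_t F d j * gen_g F d i =
    gen_g F d i * gen_t F d (tperm (ord_lo i) (ord_hi i) j).
  by rewrite -!of_freeM; apply/relator_eq/yh_tg.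
have lt_lo (i : 'I_n.-1) : ext_t i = gen_t F d (ord_lo i) by rewrite -ext_tE.
have lt_hi (i : 'I_n.-1) : ext_t i.+1 = gen_t F d (ord_hi i) by rewrite -ext_tE.
have td j : (j < n)%N -> ext_t j ^+ d = 1.
  move=> j_n; have [j' _ ->] := ti j j_n.
  by rewrite -of_freeX -(of_free1 F d n); apply/relator_eq/yh_t_order.
have [closed_t closed_g] : let S := in_span (normal_forms d ext_g ext_t n) in
    (forall j, (j < n)%N -> forall y, S y -> S (y * ext_t j)) /\
    (forall j, (j.+1 < n)%N -> forall y, S y -> S (y * ext_g j)).
  apply: (@normal_forms_closed K A d n (q - q^-1) (frac_const d%:R^-1)
    ext_g ext_t _ _ _ _ _ _ _ _ d_gt0 n (leqnn n)).
- move=> i j ij jn; have [i' e ->] := gi i (ltn_trans ij (ltnW jn)).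
  have [j' e' ->] := gi j jn; rewrite -!of_freeM.
  by apply/relator_eq/yh_comm_g; rewrite -e -e' ij.
- move=> i ij; have [i' e ->] := gi i (ltnW ij).
  have [j' e' ->] := gi i.+1 ij; rewrite -!of_freeM.
  by apply/relator_eq/yh_braid; rewrite -e -e'.
- move=> i j i_n j_n; have [i' _ ->] := ti i i_n; have [j' _ ->] := ti j j_n.
  by rewrite -!of_freeM; apply/relator_eq/yh_comm_t.
- move=> i j i_n j_n ji ji1; have [i' e ->] := gi i i_n; have [j' e' ->] := ti j j_n.
  rewrite tg tpermD //; apply/eqP => /(congr1 val) /=; rewrite -e -e'.
    by move=> h; rewrite h eqxx in ji.
  by move=> h; rewrite h eqxx in ji1.
- move=> i i_n; have [i' e ->] := gi i i_n.
  by rewrite e lt_lo tg tpermL lt_hi.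
- move=> i i_n; have [i' e ->] := gi i i_n.
  by rewrite e lt_hi tg tpermR lt_lo.
- exact: td.
- move=> i i_n; have [i' e ->] := gi i i_n.
  rewrite e lt_lo lt_hi -expr2 -of_freeX (relator_eq (@yh_quadratic F d n i')).
  rewrite of_freeD of_freeZ of_freeM of_free1 of_freeZ of_free_sum.
  congr (_ + _ *: (_ *: _ * _)).
  by apply: eq_bigr => s _; rewrite of_freeM !of_freeX.
move: x; apply: ratyh_ind.
- exact: (@normal_forms1 K A d n ext_g ext_t td d_gt0 n (leqnn n)).
- by move=> k x y Sx Sy; apply: in_spanD => //; apply: in_spanZ.
- by move=> i x; rewrite -ext_gE; apply: closed_g; apply: ord_ltn.
- by move=> j x; rewrite -ext_tE; apply: closed_t.
Qed.

Definition same_end (p : 'I_M * 'I_M) : bool :=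
  final (vacuum d n) (path_of p.1) == final (vacuum d n) (path_of p.2).

(** The index set of the matrices is in bijection with the legal paths, which
    turns the cardinal into the double sum of [sum_legal_pairs]. *)
Lemma card_same_end : #|same_end| = (d ^ n * n`!)%N.
Proof.
have sum_paths (f : seq (hop d n) -> nat) :
    (\sum_(i < M) f (path_of i) =
     \sum_(a : n.-tuple (hop d n) | legal (vacuum d n) a) f a)%N.
  transitivity (\sum_(s <- paths d n) f s)%N; last first.
    by rewrite big_map big_enum.
  rewrite (big_nth [::]) -(big_mkord predT (fun i => f (nth [::] (paths d n) i))).
  by rewrite (size_paths n d_gt0).
transitivity (\sum_(p : 'I_M * 'I_M) same_end p)%N.
  rewrite -sum1_card big_mkcond; apply: eq_bigr => p _.
  by rewrite unfold_in /same_end; case: eqP.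
rewrite -(pair_bigA _ (fun i j => same_end (i, j) : nat)) -(sum_legal_pairs d n).
under eq_bigr => i _ do
  rewrite (sum_paths (fun s =>
    final (vacuum d n) (path_of i) == final (vacuum d n) s : nat)).
rewrite (sum_paths (fun s => \sum_(b : n.-tuple (hop d n) | legal (vacuum d n) b)
  (final (vacuum d n) s == final (vacuum d n) b))%N).
rewrite big_mkcond; apply: eq_bigr => a _; case: ifP => la; last by rewrite big1.
by rewrite big_mkcond; apply: eq_bigr => b _; case: ifP.
Qed.

(** The entries at pairs of paths with a common end already determine the
    element: they can be prescribed at will, and they are as many as the normal
    forms. *)
Lemma seminormal_inj x : seminormal x = 0 -> x = 0.
Proof.
move=> x0; pose f y : 'rV[K]_(#|same_end|) :=
  \row_k seminormal y (enum_val k).1 (enum_val k).2.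
have P_alg : subalgebra (fun m => exists2 y, True & seminormal y = m).
  exact: (@seminormal_subalgebra (fun=> True)).
apply: (@in_span_faithful K A (normal_forms d ext_g ext_t n) _ f).
- by move=> k u v; apply/rowP => l; rewrite !mxE seminormalD seminormalZ !mxE.
- exact: ratyh_span.
- move=> k; have [y _ fy] : exists2 y, True &
      seminormal y = delta_mx (enum_val k).1 (enum_val k).2.
    rewrite -[(enum_val k).1](path_ofK d_gt0) -[(enum_val k).2](path_ofK d_gt0).
    apply: (@path_matrix_unit K d n q zeta d_gt0 qX fracX_inj zeta_prim _ P_alg);
      rewrite ?path_of_mem //.
    + move=> j jn; exists (gen_t F d (Ordinal jn)) => //.
      exact: seminormal_t.
    + move=> j jn; exists (pure (@laurent_incl F) 1 (yh_J F d n j)) => //.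
      exact: seminormal_J.
    + move=> j jn; have jn' : (j < n.-1)%N by rewrite ltn_predRL.
      exists (gen_g F d (Ordinal jn')) => //.
      exact: seminormal_g.
    + by have := enum_valP k; rewrite unfold_in eq_sym => /eqP.
  exists y; apply/rowP => l; rewrite !mxE fy mxE eqxx /=.
  by rewrite -xpair_eqE -!surjective_pairing (inj_eq enum_val_inj).
- by rewrite size_normal_forms; symmetry; apply: card_same_end.
- by apply/rowP => k; rewrite !mxE x0 mxE.
Qed.

(** * The maximal commutative subalgebra *)

Lemma seminormalB x y : seminormal x = seminormal y -> x = y.
Proof.
move=> xy; apply/eqP; rewrite -subr_eq0; apply/eqP/seminormal_inj.
by rewrite addrC -scaleN1r seminormalD seminormalZ xy scaleN1r addNr.
Qed.

Lemma is_subalgebraP (S : set A) : is_subalgebra S <-> subalgebra S.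
Proof.
split=> [[S1 SD SM]|[S1 SD SM]]; split.
- by rewrite inE in S1.
- by move=> k x y Sx Sy; have := SD k x y; rewrite !inE; apply.
- by move=> x y Sx Sy; have := SM x y; rewrite !inE; apply.
- by rewrite inE.
- by move=> k x y; rewrite !inE; apply: SD.
- by move=> x y; rewrite !inE; apply: SM.
Qed.

Local Notation G := (gen_subalgebra (jucys_murphy F d n)).

Lemma gen_is_subalgebra : subalgebra G.
Proof.
split.
- by move=> S [/is_subalgebraP[S1 _ _] _].
- move=> k x y Gx Gy S hS; have [/is_subalgebraP[_ SD _] _] := hS.
  by apply: SD; [apply: Gx|apply: Gy].
- move=> x y Gx Gy S hS; have [/is_subalgebraP[_ _ SM] _] := hS.
  by apply: SM; [apply: Gx|apply: Gy].
Qed.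

Lemma gen_jucys_murphy x : jucys_murphy F d n x -> G x.
Proof. by move=> Jx S [_ sS]; apply: sS. Qed.

(** Acting diagonally is stable under the operations of an algebra. *)
Lemma gen_diag x : G x -> exists c, seminormal x = diag_mx c.
Proof.
move=> Gx; apply: (Gx (fun y => exists c, seminormal y = diag_mx c)).
split.
- apply/is_subalgebraP; split.
  + by exists (const_mx 1); rewrite diag_const_mx; apply: seminormal1.
  + move=> k u v [c uc] [e ve]; exists (k *: c + e).
    by rewrite seminormalD seminormalZ uc ve linearD linearZ.
  + move=> u v [c uc] [e ve]; exists (\row_l (c 0 l * e 0 l)).
    by rewrite seminormalM uc ve mulmx_diag.
- pose x0 : hop d n := (Ordinal d_gt0, ord0).
  move=> _ [[j _ <-]|[j _ <-]].
  + exists (\row_i zeta ^+ (nth x0 (path_of i) j).1).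
    rewrite -(@diag_path_mx K d n d_gt0 (t_mx d n zeta j)
      (fun s => zeta ^+ (nth x0 s j).1)).
      exact: seminormal_t.
    by move=> s sp; apply: t_mx_nth => //; apply: path_size.
  + exists (\row_i content q (nth x0 (path_of i) j)).
    rewrite -(@diag_path_mx K d n d_gt0 (jm_mx d n q j)
      (fun s => content q (nth x0 s j))).
      by apply: seminormal_J.
    by move=> s sp; apply: jm_mx_nth => //; [apply: fracX_inj|apply: path_size].
Qed.

Lemma gen_idempotent i : exists2 x, G x & seminormal x = delta_mx i i.
Proof.
apply: (@path_idempotent K d n q zeta d_gt0 qX fracX_inj zeta_prim
  (fun m => exists2 x, G x & seminormal x = m)).
- exact/seminormal_subalgebra/gen_is_subalgebra.
- move=> j jn; exists (gen_t F d (Ordinal jn)).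
    by apply: gen_jucys_murphy; left; exists (Ordinal jn).
  exact: seminormal_t.
- move=> j jn; exists (ratyh_J F d (Ordinal jn)).
    by apply: gen_jucys_murphy; right; exists (Ordinal jn).
  exact: seminormal_J.
Qed.

(** An element [x] of a larger commutative subalgebra commutes with preimages of
    all the [E_TT] in the Jucys-Murphy algebra; so its matrix is diagonal, and it
    is the matrix of a combination of these preimages. *)
Lemma jucys_murphy_maximal : maximal_commutative_subalgebra G.
Proof.
split; first exact/is_subalgebraP/gen_is_subalgebra.
  move=> x y /gen_diag[c xc] /gen_diag[e ye]; apply: seminormalB.
  by rewrite !seminormalM xc ye; apply: diag_mxC.
move=> T T_alg T_comm GT; apply/seteqP; split=> // x Tx.
have x_diag i j : i != j -> seminormal x i j = 0.
  move=> ij; have [m Gm mE] := gen_idempotent i.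
  have := T_comm _ _ Tx (GT _ Gm) => /(congr1 seminormal).
  rewrite !seminormalM mE.
  move/(congr1 (mulmx^~ (delta_mx j j))); rewrite delta_mul_delta -mulmxA.
  rewrite mul_delta_mx_0 // mulmx0 => /matrixP/(_ i j).
  by rewrite !mxE !eqxx mulr1.
have x_sum : seminormal x = \sum_i seminormal x i i *: delta_mx i i.
  apply/matrixP => k l; rewrite [RHS]summxE [RHS](bigD1 k) //=.
  rewrite [X in _ + X]big1 => [|i ik].
    rewrite addr0 !mxE eqxx /=; have [->|kl] := eqVneq l k; first by rewrite mulr1.
    by rewrite mulr0 x_diag // eq_sym.
  by rewrite !mxE eq_sym (negbTE ik) mulr0.
have [y Gy] : exists2 y, G y & seminormal y = seminormal x.
  rewrite x_sum; have G_alg := seminormal_subalgebra gen_is_subalgebra.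
  apply: (subalgebra_sum G_alg) => i; apply: (subalgebraZ G_alg).
  exact: gen_idempotent.
by move/seminormalB <-.
Qed.

End SeminormalForm.

Lemma closed_prim_root_exists (C : numClosedFieldType) m :
  (0 < m)%N -> exists z : C, m.-primitive_root%R z.
Proof.
move=> m_gt0; have [r] := closed_field_poly_normal ('X^m - 1 : {poly C})%R.
rewrite (monicP (monicXnsubC _ m_gt0)) scale1r => rE.
suff /hasP[z _ z_prim] : has m.-primitive_root%R r by exists z.
apply: has_prim_root => //.
- by apply/allP => z; rewrite -root_prod_XsubC -rE.
- rewrite -separable_prod_XsubC -rE separable_Xn_sub_1 //.
  by rewrite Num.Theory.pnatr_eq0 -lt0n.
- by rewrite -ltnS -(size_prod_XsubC r id) -rE size_XnsubC.
Qed.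

Theorem proposition8 (R : realType) (d n : nat)
    (hd : (1 <= d)%N) (hn : (1 <= n)%N) :
  maximal_commutative_subalgebra
    (gen_subalgebra (jucys_murphy R[i] d n)).
Proof.
have [z z_prim] := closed_prim_root_exists R[i] hd.
exact: jucys_murphy_maximal hd z_prim.
Qed.
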